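(* Let $u\le w$ be permutations in $\Sigma_n$. Then \[ \mathfrak{S}_{w/u}(x)\ =\ \sum_{\gamma} x^\delta/x^\gamma, \] the sum over all increasing chains $\gamma$ in the labeled Bruhat order from $u$ to $w$.
   Context: $\Sigma_n$ is the symmetric group on $\{1,\dots,n\}$, $\ell(w)$ the number of inversions, $w_0=n\cdots 21$. Bruhat covers: $u\lessdot w$ iff $w=u\cdot(k,l)$ (swapping the entries in positions $k<l$) with $u(k)<u(l)$ and for no $k<i<l$ is $u(k)<u(i)<u(l)$. The labeled Bruhat order is the directed multigraph with an edge $u\xrightarrow{(k,b)}w$ whenever $u\lessdot w$, $u^{-1}w=(i,j)$ with $i\le k<j$ and $b=u(i)=w(j)$. A (saturated) chain $u_0\xrightarrow{(k_1,b_1)}u_1\to\cdots\xrightarrow{(k_m,b_m)}u_m$ is increasing if $(k_1,b_1)<(k_2,b_2)<\dots<(k_m,b_m)$ in lexicographic order; its monomial is $x^\gamma=\prod_{t=1}^m x_{k_t}$. Set $\delta=(n-1,n-2,\dots,1,0)$, so $x^\delta=x_1^{n-1}x_2^{n-2}\cdots x_{n-1}$. $\mathfrak{S}_w$ is the Schubert polynomial; $H^*\mathrm{F}\ell_n=\mathbb{Z}[x_1,\dots,x_n]/\langle e_1,\dots,e_n\rangle$ with $\sigma_w$ the class of $\mathfrak{S}_w$; normal form representatives are taken with respect to degree reverse lexicographic order with $x_1<\dots<x_n$; the skew Schubert polynomial $\mathfrak{S}_{w/u}(x)$ is the normal form representative of $\sigma_u\cdot\sigma_{w_0w}$. *)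

(* Defs.v *)
From HB Require Import structures.
From Stdlib Require Import ClassicalEpsilon.
From mathcomp Require Import all_boot all_order all_fingroup all_algebra.
From mathcomp Require Import generic_quotient ring_quotient fraction.
From mathcomp Require Import mpoly.

Set Implicit Arguments.
Unset Strict Implicit.
Unset Printing Implicit Defensive.

Import GRing.Theory.

Local Open Scope ring_scope.
Local Open Scope quotient_scope.

(* Positions and values of permutations, and the variables, are indexed by
   'I_n = {0, .., n-1} instead of {1, .., n}.  The product of 'S_n satisfies
   (s * t)%g i = t (s i), so the composite written u.v (first v, then u) in the
   usual convention is (v * u)%g: w = u.(i,j) is tperm i j * u, w_0 w is
   w * longest n, and u^-1 w is w * u^-1. *)

Section Bruhat.
Variable n : nat.
Implicit Types (u v w : 'S_n).

Definition longest : 'S_n := perm (@rev_ord_inj n).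

Definition bruhat_cover u w : bool :=
  [exists k : 'I_n, exists l : 'I_n,
    [&& (k < l)%N, w == (tperm k l * u)%g, (u k < u l)%N &
        [forall i : 'I_n, ~~ [&& (k < i)%N, (i < l)%N, (u k < u i)%N
                               & (u i < u l)%N]]]].

Definition bruhat_le u w : bool := connect bruhat_cover u w.

(* A label (k, b); k is a position, cutting between positions k and k+1, and
   b is a value. *)
Definition label := ('I_n * 'I_n)%type.

Definition labeled_edge u (l : label) w : bool :=
  bruhat_cover u w &&
  [exists i : 'I_n, exists j : 'I_n,
    [&& (w * u^-1)%g == tperm i j, (i <= l.1)%N, (l.1 < j)%N,
        l.2 == u i & l.2 == w j]].

(* An edge of the multigraph leaving a given vertex: its label and target.  A
   chain is the list of its edges, its starting vertex being given apart. *)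
Definition step := (label * 'S_n)%type.

Fixpoint is_chain u (g : seq step) w : bool :=
  if g is (l, v) :: g' then labeled_edge u l v && is_chain v g' w
  else u == w.

Definition label_lt : rel label := fun l1 l2 =>
  (l1.1 < l2.1)%N || ((l1.1 == l2.1) && (l1.2 < l2.2)%N).

Definition increasing (g : seq step) : bool :=
  sorted label_lt [seq e.1 | e <- g].

Definition increasing_chain u (g : seq step) w : bool :=
  is_chain u g w && increasing g.

(* Increasing chains have at most n * n edges, so that {bseq n * n of step}
   contains all of them. *)
Lemma increasing_chain_size u g w :
  increasing_chain u g w -> (size g <= n * n)%N.
Proof.
case/andP=> _ sg; rewrite -(size_map fst).
have lt_trans : transitive label_lt.
  move=> [a b] [c d] [e f]; rewrite /label_lt /= -!val_eqE /=.
  case/orP=> [h1|/andP[/eqP h1 h1']]; case/orP=> [h2|/andP[/eqP h2 h2']].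
  - by rewrite (ltn_trans h1 h2).
  - by rewrite -h2 h1.
  - by rewrite h1 h2.
  - by rewrite h1 h2 eqxx (ltn_trans h1' h2') orbT.
have lt_irr : irreflexive label_lt.
  by move=> [a b]; rewrite /label_lt /= !ltnn andbF.
have /card_uniqP <- := sorted_uniq lt_trans lt_irr sg.
by apply: leq_trans (max_card _) _; rewrite card_prod card_ord.
Qed.

End Bruhat.

Section Schubert.
Variable n : nat.
Local Notation P := {mpoly int[n]}.
Implicit Types (f p q r : P) (u w : 'S_n).

Lemma divdiff_exists (i j : 'I_n) f :
  exists g : P, f - msym (tperm i j) f == ('X_i - 'X_j) * g.
Proof.
elim/mpolyind: f => [|c m p _ _ [g /eqP Hg]].
  by exists 0; rewrite msym0 subr0 mulr0.
suff [h Hh] : exists h : P,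
    'X_[m] - msym (tperm i j) 'X_[m] = ('X_i - 'X_j) * h.
  exists (c *: h + g); rewrite msymD msymZ mulrDr -scalerAr -Hg -Hh.
  by rewrite scalerBr opprD addrACA.
rewrite mpolyXE_id; elim/big_rec: _ => [|k y _ [h Hh]].
  by exists 0; rewrite msym1 subrr mulr0.
have [a Ha] : exists a : P,
    'X_k ^+ m k - msym (tperm i j) ('X_k ^+ m k) = ('X_i - 'X_j) * a.
  elim: (m k) => [|e [a Ha]]; first by exists 0; rewrite expr0 msym1 subrr mulr0.
  have [b Hb] : exists b : P,
      'X_k - msym (tperm i j) 'X_k = ('X_i - 'X_j) * b.
    rewrite /msym mmapX mmap1U; case: tpermP => [->|->|_ _].
    - by exists 1; rewrite mulr1.
    - by exists (-1); rewrite mulrN1 opprB.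
    - by exists 0; rewrite subrr mulr0.
  exists (b * 'X_k ^+ e + msym (tperm i j) 'X_k * a).
  rewrite mulrDr mulrA -Hb mulrCA -Ha exprS msymM mulrBl mulrBr.
  by rewrite addrA subrK.
exists (a * y + msym (tperm i j) ('X_k ^+ m k) * h).
rewrite mulrDr mulrA -Ha mulrCA -Hh msymM mulrBl mulrBr.
by rewrite addrA subrK.
Qed.

(* (f - s f) / (x_i - x_j), where s exchanges x_i and x_j; it is uniquely
   determined when i != j. *)
Definition divdiff (i j : 'I_n) f : P := xchoose (divdiff_exists i j f).

Lemma divdiffE (i j : 'I_n) f :
  f - msym (tperm i j) f = ('X_i - 'X_j) * divdiff i j f.
Proof. exact/eqP/(xchooseP (divdiff_exists i j f)). Qed.

Definition delta : 'X_{1..n} := [multinom (n - i.+1)%N | i < n].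

(* S_{w_0} = x^delta, and S_w = d_i S_{w s_i} whenever w(i) < w(i+1), where d_i
   is the divided difference in x_i and x_{i+1}.  By the braid relations the
   choice of the ascent is immaterial; the fuel n * n exceeds the number of
   non-inversions of w. *)
Fixpoint schubert_rec (fuel : nat) w : P :=
  if fuel is fuel'.+1 then
    if [pick a : 'I_n * 'I_n | (a.2 == a.1.+1 :> nat) && (w a.1 < w a.2)%N]
      is Some a
    then divdiff a.1 a.2 (schubert_rec fuel' (tperm a.1 a.2 * w)%g)
    else 'X_[delta]
  else 'X_[delta].

Definition schubert w : P := schubert_rec (n * n) w.

(* The ideal <e_1, .., e_n>; membership is made boolean by excluded middle. *)
Definition in_coinv_ideal p : Prop :=
  exists c : 'I_n -> P, p = \sum_(i < n) c i * mesym n int i.+1.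

Definition coinv_ideal : {pred P} := fun p =>
  if excluded_middle_informative (in_coinv_ideal p) then true else false.

Lemma coinv_idealP p : reflect (in_coinv_ideal p) (p \in coinv_ideal).
Proof.
by rewrite unfold_in /coinv_ideal; case: excluded_middle_informative => h;
  constructor.
Qed.

Lemma coinv_ideal_closed : idealr_closed coinv_ideal.
Proof.
split.
- by apply/coinv_idealP; exists (fun=> 0); rewrite big1 // => i _; rewrite mul0r.
- apply/coinv_idealP=> -[c /(congr1 (meval (fun=> 0)))].
  rewrite rmorph1 rmorph_sum big1 => [/eqP|i _]; first by rewrite oner_eq0.
  rewrite rmorphM /= [X in _ * X](_ : _ = 0) ?mulr0 //.
  rewrite /mesym rmorph_sum big1 // => h /eqP hi.
  have /card_gt0P[x xh] : (0 < #|h|)%N by rewrite hi.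
  by rewrite rmorph_prod (bigD1 x) //= mevalXU mul0r.
- move=> a p q /coinv_idealP[c ->] /coinv_idealP[d ->]; apply/coinv_idealP.
  exists (fun i => a * c i + d i); rewrite mulr_sumr -big_split.
  by apply: eq_bigr => i _; rewrite mulrDl mulrA.
Qed.

HB.instance Definition _ := isIdealr.Build P coinv_ideal coinv_ideal_closed.

Definition flag_cohomology := {ideal_quot coinv_ideal}.

Definition flag_class p : flag_cohomology := \pi_{ideal_quot coinv_ideal} p.

Definition schubert_class w : flag_cohomology := flag_class (schubert w).

(* Degree reverse lexicographic order with x_1 < ... < x_n: in equal degrees,
   at the smallest variable where the exponents differ, the larger exponent
   gives the smaller monomial.  (The order <%O that the library puts on
   monomials is a different one.) *)
Definition degrevlex_lt (m1 m2 : 'X_{1..n}) : bool :=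
  (mdeg m1 < mdeg m2)%N ||
  (mdeg m1 == mdeg m2) &&
  [exists i : 'I_n,
    (m2 i < m1 i)%N && [forall j : 'I_n, (j < i)%N ==> (m1 j == m2 j)]].

Definition is_leading_monomial (m : 'X_{1..n}) p : Prop :=
  m \in msupp p /\
  forall m', m' \in msupp p -> m' != m -> degrevlex_lt m' m.

(* The leading terms of the ideal are generated by the monic x_i^(n-i+1), i in
   1..n, so over the integers too only leading monomials matter. *)
Definition reduced r : Prop :=
  forall m, m \in msupp r ->
  forall p, p \in coinv_ideal -> ~ is_leading_monomial m p.

Definition is_normal_form (c : flag_cohomology) r : Prop :=
  flag_class r = c /\ reduced r.

(* A class has at most one normal form: the difference of two would have as its
   leading monomial a monomial of one of them. *)
Definition normal_form (c : flag_cohomology) : P :=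
  epsilon (inhabits 0) (is_normal_form c).

Definition skew_schubert u w : P :=
  normal_form (schubert_class u * schubert_class (w * longest n)%g).

Definition chain_monomial (g : seq (step n)) : P := \prod_(e <- g) 'X_(e.1.1).

End Schubert.

(* Main.v *)
(** The degree map of the flag manifold sends p to the coefficient integ p of
    x^delta in its antisymmetrization.  It vanishes on <e_1, .., e_n> and makes
    the divided differences self-adjoint, whence integ (S_v S_w) = [w = w_0 v].
    The reduced polynomials are the combinations of the x^a with a <= delta, and
    integ (x^(delta-b) prod_(k < i) (1 - x_i y_k)) = y^b; so the coefficient of
    x^(delta-b) in the normal form of a class c is the coefficient of y^b in
    integ (c prod_(k < i) (1 - x_i y_k)).

    In the cohomology ring, prod_(i > k) (1 - x_i y) is the inverse of
    prod_(i <= k) (1 - x_i y), and by Pieri's rule its product with S_u is the sum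
    of y^length S_v over the increasing chains from u to v with labels (k, b).
    Multiplying over all k and pairing with S_(w_0 w) counts the increasing chains
    from u to w by their monomial.

    Pieri's rule follows from Monk's.  Let D_b^k be the sum over the edges labeled
    (k, b) and E_b = D_b^k - D_b^(k-1), so that multiplication by x_k is the sum
    of the E_b.  On chains of two edges, D_b^k (sum_(c <= b) E_c) =
    (sum_(c < b) E_c) D_b^(k-1), which telescopes to
    prod_b (1 + y D_b^k) (1 - y x_k) = prod_b (1 + y D_b^(k-1)). *)

From HB Require Import structures.
Require Import Defs.
From Stdlib Require Import FunctionalExtensionality ClassicalEpsilon.
From mathcomp Require Import all_boot all_order all_fingroup all_algebra.
From mathcomp Require Import generic_quotient ring_quotient fraction mpoly.
From mathcomp Require Import ring zify.

Set Implicit Arguments.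
Unset Strict Implicit.
Unset Printing Implicit Defensive.

Import GRing.Theory.

Local Open Scope ring_scope.

Local Notation "m ## s" := [multinom m (s i) | i < _]
  (at level 40, left associativity).

(** The y of the generating functions live in a coefficient ring R, and up to the counting of chains
    everything is done modulo the radical of the pairing [integ (p * q)]: it is defined over any R,
    and congruences between integral polynomials extend to R. In the end R is [{mpoly int[n]}]
    itself with y_k = x_k, so that the weight of a chain is its monomial; inverting the variables
    and multiplying by x^delta then gives the required quotients.

    The operators act on functions G of a permutation, not on polynomials: a sum over the edges
    leaving u is applied to v |-> S_v. In a product of factors 1 + y D the outermost one thus
    carries the first edge of a chain. All that Pieri's rule uses of G is Monk's congruence for
    every x_i, which lets a multiplication by x_k be traded for a sum over covers inside a block. *)

(** [h] exchanges even and odd permutations and preserves [F], so the even terms cancel the odd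
    ones. Splitting by parity avoids concluding from 2 x = 0. *)
Lemma alt_sum0 n (R : comNzRingType) (h : 'S_n -> 'S_n) (F : 'S_n -> R) :
    injective h -> (forall s, odd_perm (h s) = ~~ odd_perm s) ->
    (forall s, F (h s) = F s) ->
  \sum_(s : 'S_n) (-1) ^+ s * F s = 0.
Proof.
move=> h_inj h_odd hF.
rewrite (bigID (fun s : 'S_n => odd_perm s)) /= (reindex_inj h_inj) /=.
under eq_bigl do rewrite h_odd.
rewrite -big_split /= big1 // => s hs.
by rewrite h_odd hF hs (negPf hs) mulN1r mul1r addNr.
Qed.

(** * The degree map *)

Section Integ.
Variables (n : nat) (R : comNzRingType).
Implicit Types (p q r : {mpoly R[n]}) (m : 'X_{1..n}) (s t : 'S_n).

Definition integ p : R := \sum_(s : 'S_n) (-1) ^+ s * p@_(delta n ## s).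

Lemma integ_is_linear : linear_for *%R integ.
Proof.
move=> a p q; rewrite /integ mulr_sumr -big_split /=; apply: eq_bigr => s _.
by rewrite mcoeffD mcoeffZ mulrDr mulrCA.
Qed.

HB.instance Definition _ :=
  GRing.isLinear.Build R {mpoly R[n]} R *%R integ integ_is_linear.

Lemma integ_sym0 (i j : 'I_n) p :
  i != j -> msym (tperm i j) p = p -> integ p = 0.
Proof.
move=> ij sp; apply: (alt_sum0 (h := fun s => (tperm i j * s)%g)).
- exact: mulgI.
- by move=> s; rewrite odd_permM odd_tperm ij.
- by move=> s; rewrite mpermM -mcoeff_sym sp.
Qed.

Lemma delta_inj (i j : 'I_n) : delta n i = delta n j -> i = j.
Proof.
rewrite !mnmE => h; apply/val_inj => /=.
apply/succn_inj/eqP; rewrite -(eqn_sub2lE (m := n)) ?h //; exact: ltn_ord.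
Qed.

(** Both sides have the same sum over i, so all the inequalities are equalities, and delta has
    distinct entries. *)
Lemma perm_delta_le s : (forall i, delta n i <= delta n (s i))%N -> s = 1%g.
Proof.
move=> le_s; suff eq_s i : delta n (s i) = delta n i.
  by apply/permP => i; rewrite perm1; apply/delta_inj/eq_s.
have : (\sum_i delta n i = \sum_i delta n (s i))%N.
  by rewrite [LHS](reindex_inj (@perm_inj _ s)).
move/eqP; rewrite eq_sym => /eqP h.
have /leqif_sum /= [_] : forall i : 'I_n, true ->
    (delta n i <= delta n (s i) ?= iff (delta n i == delta n (s i)))%N.
  by move=> k _; split.
by rewrite h eqxx => /esym/forallP/(_ i) /eqP.
Qed.

Lemma mcoeffMX0 p m k : ~~ (m <= k)%MM -> (p * 'X_[m])@_k = 0.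
Proof.
move=> nmk; apply: memN_msupp_eq0; rewrite (perm_mem (msuppMX p m)).
by apply/negP => /mapP[m' _ km]; rewrite km lem_addr in nmk.
Qed.

(** A permuted delta whose monomial is divisible by x^delta is delta itself, so only the identity
    permutation contributes. *)
Lemma integ_delta p : integ ('X_[delta n] * p) = p@_0%MM.
Proof.
rewrite mulrC /integ (bigD1 1%g) //= odd_perm1 mul1r mperm1.
have -> : (p * 'X_[delta n])@_(delta n) = p@_0%MM.
  by rewrite -[in RHS](mcoeffMX p (delta n)) addm0.
rewrite big1 ?addr0 // => s s1; rewrite mcoeffMX0 ?mulr0 //.
apply: contra s1 => /mnm_lepP le_s; apply/eqP/perm_delta_le => i.
by have := le_s i; rewrite mnmE.
Qed.

(** Descending induction on the index: if m i < delta i, then the later position n - 1 - m i, where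
    m already agrees with delta, carries the value m i too, against injectivity. *)
Lemma injective_le_delta m :
  (forall i, m i <= delta n i)%N -> injective m -> m = delta n.
Proof.
move=> le_m m_inj; apply/mnmP => i.
have [d] := ubnP (n - i); elim: d i => // d IHd i; rewrite ltnS => led.
apply/eqP; rewrite eqn_leq le_m /= leqNgt; apply/negP => lt_i.
have lt_n : (n - (m i).+1 < n)%N.
  by rewrite ltn_subrL (leq_ltn_trans _ (ltn_ord i)).
have lt_j : (i < n - (m i).+1)%N by move: lt_i; rewrite mnmE !ltn_subRL addnC addSn addnS.
have /m_inj/(congr1 val)/= e : m (Ordinal lt_n) = m i.
  rewrite IHd /=; last by apply: leq_trans led; rewrite ltn_sub2l.
  rewrite mnmE /= subnS subKn //.
  by apply: leq_ltn_trans (le_m i) _; rewrite mnmE ltn_subrL (leq_ltn_trans _ (ltn_ord i)).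
by rewrite e ltnn in lt_j.
Qed.

(** Antisymmetrizing p r gives p A with A the antisymmetrization of r. A term of x^delta in p A
    takes from A an exponent k2 <= delta; unless k2 = delta, which would use the constant term of p,
    it has a repeated entry, and A has no such monomial. *)
Lemma integ_symM p r : p \is symmetric -> p@_0%MM = 0 -> integ (p * r) = 0.
Proof.
move=> /issymP p_sym p0.
pose A := \sum_(s : 'S_n) (-1) ^+ s *: msym s r.
have -> : integ (p * r) = (p * A)@_(delta n).
  rewrite mulr_sumr raddf_sum /=; apply: eq_bigr => s _.
  by rewrite -scalerAr mcoeffZ -{2}(p_sym s) -msymM mcoeff_sym.
have A0 m (i j : 'I_n) : i != j -> m i = m j -> A@_m = 0.
  move=> ij mij; rewrite raddf_sum /=.
  under eq_bigr do rewrite mcoeffZ mcoeff_sym.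
  apply: (alt_sum0 (h := fun s => (s * tperm i j)%g)).
  - exact: mulIg.
  - by move=> s; rewrite odd_permM odd_tperm ij addbT.
  move=> s; rewrite mpermM (_ : m ## tperm i j = m) //.
  by apply/mnmP => k; rewrite mnmE; case: tpermP => [->|->|].
rewrite mcoeffM big1 // => -[[k1 b1] [k2 b2]] /= {b1 b2} /eqP e.
have [->|k1_neq0] := eqVneq k1 0%MM; first by rewrite p0 mul0r.
have k2_le i : (k2 i <= delta n i)%N by rewrite e mnmDE leq_addl.
suff [i [j [ij mij]]] : exists i j, i != j /\ k2 i = k2 j.
  by rewrite (A0 _ _ _ ij mij) mulr0.
have /injectivePn[i [j ij h]] : ~~ injectiveb (fun i => k2 i).
  apply/injectiveP => /(injective_le_delta k2_le) e2.
  move: k1_neq0; rewrite e2 in e; rewrite -mdeg_eq0.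
  by move/(congr1 (@mdeg n)): e => /eqP; rewrite mdegD -{1}[mdeg _]add0n eqn_add2r => /eqP <-.
by exists i, j.
Qed.

(* Congruence modulo the radical of the pairing integ (p * q); it is coarser than
   congruence modulo the ideal, and makes sense over any ring R. *)
Definition eqv p q := forall r, integ (p * r) = integ (q * r).

Lemma eqv_refl p : eqv p p. Proof. by []. Qed.
Lemma eqv_sym p q : eqv p q -> eqv q p. Proof. by move=> h r; rewrite h. Qed.
Lemma eqv_trans q p r : eqv p q -> eqv q r -> eqv p r.
Proof. by move=> h1 h2 x; rewrite h1. Qed.
Lemma eqvD p q p' q' : eqv p q -> eqv p' q' -> eqv (p + p') (q + q').
Proof. by move=> h1 h2 x; rewrite !mulrDl !raddfD /= h1 h2. Qed.
Lemma eqvM p q p' q' : eqv p q -> eqv p' q' -> eqv (p * p') (q * q').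
Proof. by move=> h1 h2 x; rewrite -!mulrA h1 mulrCA h2 mulrCA. Qed.
Lemma eqv_sum (I : Type) (r : seq I) (P : pred I) (F G : I -> {mpoly R[n]}) :
  (forall i, P i -> eqv (F i) (G i)) ->
  eqv (\sum_(i <- r | P i) F i) (\sum_(i <- r | P i) G i).
Proof. by move=> h; elim/big_ind2: _ => // *; exact: eqvD. Qed.
Lemma eqvMl a p q : eqv p q -> eqv (a * p) (a * q). Proof. exact: eqvM. Qed.
Lemma eqvB p q p' q' : eqv p q -> eqv p' q' -> eqv (p - p') (q - q').
Proof. by move=> h1 h2 x; rewrite !mulrBl !raddfB /= h1 h2. Qed.

Lemma eqv_integ p q : eqv p q -> integ p = integ q.
Proof. by move/(_ 1); rewrite !mulr1. Qed.

Lemma eqv_sym0 p : p \is symmetric -> p@_0%MM = 0 -> eqv p 0.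
Proof. by move=> sp p0 r; rewrite integ_symM // mul0r raddf0. Qed.

End Integ.

(** * A dual basis of monomials *)

Section Pairing.
Variables (n : nat) (R : comNzRingType).
Implicit Types (p q r F : {mpoly R[n]}) (m : 'X_{1..n}) (s t : 'S_n) (x : R).

Lemma msymXU s i : msym s ('X_i : {mpoly R[n]}) = 'X_(s i).
Proof. by rewrite /msym mmapX mmap1U. Qed.

Lemma msymXn s i k : msym s ('X_i ^+ k : {mpoly R[n]}) = 'X_(s i) ^+ k.
Proof. by rewrite rmorphXn /= msymXU. Qed.

Lemma msym_prod s (P : pred 'I_n) (g : 'I_n -> {mpoly R[n]}) :
    (forall i, P (s i) = P i) -> (forall i, P i -> msym s (g i) = g (s i)) ->
  msym s (\prod_(i | P i) g i) = \prod_(i | P i) g i.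
Proof.
move=> Ps gs; rewrite rmorph_prod [RHS](reindex_inj (@perm_inj _ s)) /=.
by apply: eq_big => i; rewrite ?Ps // => /gs.
Qed.

Definition tail_inv k F :=
  forall i j : 'I_n, (k <= i)%N -> (k <= j)%N -> msym (tperm i j) F = F.

Definition tail_prod k x : {mpoly R[n]} := \prod_(i < n | (k <= i)%N) (1 - x *: 'X_i).

Definition tail_delta k : {mpoly R[n]} := \prod_(i < n | (k <= i)%N) 'X_i ^+ (n - i.+1).

Lemma tail_invM k F p : tail_inv k F -> tail_inv k p -> tail_inv k (F * p).
Proof. by move=> hF hp i j ki kj; rewrite rmorphM /= hF ?hp. Qed.

Lemma tail_invW k l F : (k <= l)%N -> tail_inv k F -> tail_inv l F.
Proof. by move=> kl hF i j li lj; rewrite hF // (leq_trans kl). Qed.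

Lemma tail_inv_tail k x : tail_inv k (tail_prod k x).
Proof.
move=> i j ki kj; apply: msym_prod => [l|l _]; first by case: tpermP => [->|->|]; rewrite ?ki ?kj.
by rewrite msymB msym1 msymZ msymXU.
Qed.

Lemma tail_prod_fix k x (i j : 'I_n) : (i < k)%N -> (j < k)%N ->
  msym (tperm i j) (tail_prod k x) = tail_prod k x.
Proof.
move=> ik jk; apply: msym_prod => [l|l kl].
  by case: tpermP => [->|->|]; rewrite ?(leqNgt k) ?ik ?jk.
by rewrite msymB msym1 msymZ msymXU.
Qed.

Lemma tail_invX k (i : 'I_n) e : (i < k)%N -> tail_inv k ('X_i ^+ e).
Proof.
move=> ik a b ka kb; rewrite msymXn tpermD //.
  by apply: contraTneq ik => <-; rewrite -leqNgt.
by apply: contraTneq ik => <-; rewrite -leqNgt.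
Qed.

Lemma leq_ordD1 (k i : 'I_n) : (k <= i)%N && (i != k) = (k < i)%N.
Proof. by rewrite ltn_neqAle andbC eq_sym. Qed.

Lemma tail_prodS (k : 'I_n) x : tail_prod k x = (1 - x *: 'X_k) * tail_prod k.+1 x.
Proof.
rewrite /tail_prod (bigD1 k) //=; congr (_ * _).
by apply: eq_bigl => i; rewrite leq_ordD1.
Qed.

Lemma tail_deltaS (k : 'I_n) : tail_delta k = 'X_k ^+ (n - k.+1) * tail_delta k.+1.
Proof.
rewrite /tail_delta (bigD1 k) //=; congr (_ * _).
by apply: eq_bigl => i; rewrite leq_ordD1.
Qed.

Lemma tail_prod_n x : tail_prod n x = 1.
Proof. by rewrite /tail_prod big_pred0 // => i; rewrite leqNgt ltn_ord. Qed.

(** The vanishing behind both evaluations below: with equal exponents at a and b the argument is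
    fixed by exchanging x_a and x_b. *)
Lemma integ_repeat k (a b : 'I_n) F e (f : 'I_n -> nat) :
    (k <= a)%N -> (k <= b)%N -> a != b -> msym (tperm a b) F = F ->
  integ (F * ('X_a ^+ e * 'X_b ^+ e *
     \prod_(i < n | (k <= i)%N && ((i != a) && (i != b))) 'X_i ^+ f i)) = 0.
Proof.
move=> ka kb ab hF; apply: (integ_sym0 ab).
rewrite !rmorphM /= hF !msymXn tpermL tpermR; congr (_ * _).
rewrite [X in X * _]mulrC; congr (_ * _); apply: msym_prod => i.
  by case: tpermP => [->|->|/eqP/negPf -> /eqP/negPf ->]; rewrite ?eqxx ?andbF.
by case/andP=> _ /andP[ia ib]; rewrite msymXn tpermD // eq_sym.
Qed.

Lemma tail_deltaD2 k (a b : 'I_n) : (k <= a)%N -> (k <= b)%N -> a != b ->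
  tail_delta k = 'X_a ^+ (n - a.+1) * 'X_b ^+ (n - b.+1) *
     \prod_(i < n | (k <= i)%N && ((i != a) && (i != b))) 'X_i ^+ (n - i.+1).
Proof.
move=> ka kb ab; rewrite /tail_delta (bigD1 a) //= (bigD1 b) ?kb 1?eq_sym //=.
by rewrite mulrA; congr (_ * _); apply: eq_bigl => i; rewrite andbA.
Qed.

(** Descending induction on c: the term x_c of the factor 1 - x x_c raises the exponent of x_c to
    that of x_(c-1), so it contributes 0. Since k < c, the variable x_(c-1) is still one in which F
    is symmetric. *)
Lemma integ_tail_prod1 k c F x : (k < c)%N -> (c <= n)%N -> tail_inv k F ->
  integ (F * tail_delta k * tail_prod c x) = integ (F * tail_delta k).
Proof.
move=> kc cn hF; have [d] := ubnP (n - c); elim: d c kc cn => // d IHd c kc.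
rewrite leq_eqVlt => /predU1P[->|cn led]; first by rewrite tail_prod_n mulr1.
rewrite (tail_prodS (Ordinal cn)) /= mulrBl mul1r mulrBr raddfB /=.
rewrite IHd // 1?(ltn_trans kc) //; last first.
  by rewrite -ltnS (leq_trans _ led) // ltnS ltn_sub2l.
rewrite -scalerAl -scalerAr linearZ /=.
suff -> : integ (F * tail_delta k * ('X_(Ordinal cn) * tail_prod c.+1 x)) = 0.
  by rewrite mulr0 subr0.
case: c kc cn led => // c kc cn _; have cn' : (c < n)%N by rewrite ltnW.
pose a := Ordinal cn'; pose b := Ordinal cn.
have ab : a != b by rewrite -val_eqE /= neq_ltn ltnSn.
rewrite (tail_deltaD2 (a := a) (b := b)) //=; last by rewrite ltnW.
set u := \prod_(i | _) _.
rewrite (_ : _ * (_ * _) = F * tail_prod c.+2 x *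
    ('X_a ^+ (n - c.+1) * 'X_b ^+ (n - c.+1) * u)); last first.
  rewrite (_ : (n - c.+1 = (n - c.+2).+1)%N) ?exprS; last by rewrite -subSn.
  by rewrite -/b; ring.
rewrite integ_repeat //; first by rewrite ltnW.
by rewrite rmorphM /= hF ?tail_prod_fix // ltnW.
Qed.

(* With q_b the left-hand side, q_(b+1) - x q_b is the degree of a polynomial in
   which x_k and x_(k+b+1) have the same exponent, up to a factor symmetric in
   the variables of index at least k; hence it vanishes. *)
Lemma integ_tail_step (k : 'I_n) b F x : (b < n - k)%N -> tail_inv k F ->
  integ (F * ('X_k ^+ (n - k.+1 - b) * tail_prod k.+1 x) * tail_delta k.+1) =
  x ^+ b * integ (F * tail_delta k).
Proof.
elim: b => [|b IHb] bk hF.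
  rewrite subn0 mul1r -(integ_tail_prod1 (c := k.+1) x _ _ hF) //.
  by rewrite tail_deltaS; congr integ; ring.
have ltb : (b < n - k.+1)%N by rewrite subnS -ltnS prednK // (leq_ltn_trans _ bk).
rewrite [x ^+ b.+1]exprS -(mulrA x) -IHb ?(ltnW bk) // -linearZ /=; apply/eqP.
rewrite -subr_eq0 -raddfB /=.
have -> : (n - k.+1 - b = (n - k.+1 - b.+1).+1)%N by rewrite -subSn.
set e := (n - k.+1 - b.+1)%N.
rewrite (_ : _ - _ = F * tail_prod k x * ('X_k ^+ e * tail_delta k.+1)); last first.
  by rewrite tail_prodS exprS -mul_mpolyC -[x *: 'X_k]mul_mpolyC; ring.
have lt_l : (k + b.+1 < n)%N by rewrite -ltn_subRL.
pose l := Ordinal lt_l.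
have lk : l != k by rewrite -val_eqE /= -[X in _ != X]addn0 eqn_add2l.
have e_l : (e = n - l.+1)%N by rewrite /e /= -subnDA addSn.
rewrite (_ : _ * tail_delta _ = 'X_k ^+ e * 'X_l ^+ e *
     \prod_(i < n | (k <= i)%N && ((i != k) && (i != l))) 'X_i ^+ (n - i.+1)); last first.
  rewrite /tail_delta (bigD1 l) /= ?mulrA; last by rewrite -addSnnS leq_addr.
  rewrite e_l; congr (_ * _); apply: eq_bigl => i.
  by rewrite andbA leq_ordD1.
rewrite integ_repeat ?eqxx //.
- by rewrite leq_addr.
- by rewrite eq_sym.
by rewrite rmorphM /= hF ?leq_addr // (tail_inv_tail x) //= leq_addr.
Qed.

(** Induction on the number of tail variables. The factor of index k is absorbed into F, which stays
    symmetric in the variables beyond k; the induction hypothesis evaluates the later factors, and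
    [integ_tail_step] then the factor k. *)
Lemma integ_tail_pairing k (b : 'I_n -> nat) (y : 'I_n -> R) F :
    (k <= n)%N -> tail_inv k F -> (forall i : 'I_n, b i < n - i)%N ->
  integ (F * \prod_(i < n | (k <= i)%N) ('X_i ^+ (n - i.+1 - b i) * tail_prod i.+1 (y i))) =
  (\prod_(i < n | (k <= i)%N) y i ^+ b i) * integ (F * tail_delta k).
Proof.
move=> + + hb; have [d] := ubnP (n - k); elim: d k F => // d IHd k F.
move=> ltd; rewrite leq_eqVlt => /predU1P[->|kn] hF.
  by rewrite /tail_delta !big_pred0 ?mulr1 ?mul1r // => i; rewrite leqNgt ltn_ord.
rewrite !(bigD1 (Ordinal kn) (leqnn k)) /=.
rewrite !(eq_bigl (fun i : 'I_n => (k < i)%N) _ (leq_ordD1 (Ordinal kn))).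
rewrite mulrA IHd //=; last 2 first.
- by rewrite -ltnS (leq_trans _ ltd) // ltnS ltn_sub2l.
- apply: tail_invM; first exact: tail_invW hF.
  by apply: tail_invM; [exact: tail_invX|exact: tail_inv_tail].
rewrite (integ_tail_step (y (Ordinal kn)) (hb (Ordinal kn)) hF).
by rewrite mulrCA mulrA.
Qed.

Definition kernel (y : 'I_n -> R) : {mpoly R[n]} := \prod_(k < n) tail_prod k.+1 (y k).

Lemma integ_kernel (y : 'I_n -> R) (b : 'X_{1..n}) : (b <= delta n)%MM ->
  integ (kernel y * 'X_[delta n - b]) = \prod_i y i ^+ b i.
Proof.
move=> /mnm_lepP hb.
have -> : kernel y * 'X_[delta n - b] = 1 * \prod_(i < n | (0 <= i)%N)
    ('X_i ^+ (n - i.+1 - b i) * tail_prod i.+1 (y i)).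
  rewrite mul1r big_split mulrC /=; congr (_ * _).
  by rewrite mpolyXE_id; apply: eq_bigr => i _; rewrite !mnmE.
rewrite integ_tail_pairing //; first last.
- by move=> i; have := hb i; rewrite mnmE subnS -ltnS prednK // subn_gt0.
- by move=> i j _ _; rewrite msym1.
rewrite mul1r (_ : tail_delta 0 = 'X_[delta n] * 1) ?integ_delta ?mcoeff1 ?eqxx ?mulr1 //.
by rewrite mpolyXE_id; apply: eq_bigr => i _; rewrite mnmE.
Qed.

End Pairing.

(** * Divided differences *)

Section DivDiffTheory.
Variables (n : nat) (A : idomainType) (act : 'S_n -> {rmorphism A -> A}).
Variables (X : 'I_n -> A) (dd : 'I_n -> 'I_n -> A -> A).
Hypotheses (actM : forall s t f, act (s * t)%g f = act t (act s f)).
Hypotheses (act1 : forall f, act 1%g f = f) (actX : forall s i, act s (X i) = X (s i)).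
Hypothesis X_inj : injective X.
Hypothesis ddE : forall i j f, f - act (tperm i j) f = (X i - X j) * dd i j f.
Implicit Types (f g : A) (i j k l : 'I_n).

Lemma subX_neq0 i j : i != j -> X i - X j != 0.
Proof. by rewrite subr_eq0 (inj_eq X_inj). Qed.

(** A divided difference is known only through [ddE], which determines it because A is a domain; the
    identities below rest on such cancellations. *)
Lemma dd_uniq i j f g : i != j ->
  (X i - X j) * g = f - act (tperm i j) f -> dd i j f = g.
Proof. by move=> ij h; apply: (mulfI (subX_neq0 ij)); rewrite -ddE h. Qed.

Lemma dd_fix i j f : i != j -> act (tperm i j) f = f -> dd i j f = 0.
Proof. by move=> ij h; apply: dd_uniq => //; rewrite h subrr mulr0. Qed.

Lemma act_tpermK i j f : act (tperm i j) (act (tperm i j) f) = f.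
Proof. by rewrite -actM tperm2 act1. Qed.

Lemma act_dd i j f : i != j -> act (tperm i j) (dd i j f) = dd i j f.
Proof.
move=> ij; apply: (mulfI (subX_neq0 ij)).
have := congr1 (act (tperm i j)) (ddE i j f).
rewrite rmorphB act_tpermK rmorphM rmorphB !actX tpermL tpermR => e.
by rewrite -ddE -[LHS]opprK -mulNr opprB -e opprB.
Qed.

Lemma ddB i j f g : i != j -> dd i j (f - g) = dd i j f - dd i j g.
Proof. by move=> ij; apply: dd_uniq; rewrite ?rmorphB // mulrBr -!ddE; ring. Qed.

Lemma ddD i j f g : i != j -> dd i j (f + g) = dd i j f + dd i j g.
Proof. by move=> ij; apply: dd_uniq; rewrite ?rmorphD // mulrDr -!ddE; ring. Qed.

Lemma dd_sum i j (I : Type) (r : seq I) (Q : pred I) (F : I -> A) : i != j ->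
  dd i j (\sum_(a <- r | Q a) F a) = \sum_(a <- r | Q a) dd i j (F a).
Proof.
move=> ij; apply: (big_morph (dd i j)) => [f g|]; first exact: ddD.
by apply: dd_fix; rewrite ?rmorph0.
Qed.

Lemma ddC i j f : i != j -> dd j i f = - dd i j f.
Proof.
move=> ij; apply: dd_uniq; first by rewrite eq_sym.
by rewrite tpermC ddE; ring.
Qed.

Lemma ddXl i j f : i != j -> dd i j (X i * f) = f + X j * dd i j f.
Proof.
move=> ij; apply: dd_uniq => //; rewrite rmorphM actX tpermL mulrDr mulrCA -ddE.
by ring.
Qed.

Lemma ddXr i j f : i != j -> dd i j (X j * f) = X i * dd i j f - f.
Proof.
move=> ij; apply: dd_uniq => //; rewrite rmorphM actX tpermR mulrBr mulrCA -ddE.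
by ring.
Qed.

Lemma ddXn i j k f : i != j -> k != i -> k != j ->
  dd i j (X k * f) = X k * dd i j f.
Proof.
move=> ij ki kj; apply: dd_uniq => //.
by rewrite rmorphM actX tpermD 1?eq_sym // mulrCA -ddE mulrBr.
Qed.

Lemma act_ddE (s : 'S_n) i j f :
  (X (s i) - X (s j)) * act s (dd i j f) = act s f - act s (act (tperm i j) f).
Proof. by rewrite -rmorphB ddE rmorphM rmorphB !actX. Qed.

Lemma dd_comm i j k l f : i != j -> k != l -> i != k -> i != l -> j != k -> j != l ->
  dd i j (dd k l f) = dd k l (dd i j f).
Proof.
move=> ij kl ik il jk jl.
apply: (mulfI (subX_neq0 kl)); apply: (mulfI (subX_neq0 ij)).
rewrite -[in RHS]ddE mulrCA -ddE mulrBr -ddE mulrBr -ddE.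
have := act_ddE (tperm i j) k l f; rewrite !tpermD // => ->.
have := act_ddE (tperm k l) i j f; rewrite !tpermD 1?eq_sym // => ->.
rewrite -!actM (_ : (tperm k l * tperm i j = tperm i j * tperm k l)%g).
  by rewrite !opprB addrACA [X in _ + X]addrC addrACA.
by rewrite conjgC tpermJ !tpermD // eq_sym.
Qed.

(** The right-hand side is the alternating sum of f over the six permutations of i, j, k, and the
    factor on the left is the Vandermonde product. *)
Lemma dd3E i j k f : i != j -> j != k -> i != k ->
  (X i - X j) * (X j - X k) * (X i - X k) *
     dd i j (dd j k (dd i j f)) =
  f - act (tperm i j) f - (act (tperm j k) f - act (tperm i j * tperm j k)%g f)
    + (act (tperm j k * tperm i j)%g f
       - act (tperm i j * tperm j k * tperm i j)%g f).
Proof.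
move=> ij jk ik; set g := dd i j f; set h := dd j k g.
have sk : tperm i j k = k by rewrite tpermD // eq_sym.
have ti : tperm j k i = i by rewrite tpermD // eq_sym.
have e1 : (X i - X j) * dd i j h = h - act (tperm i j) h by rewrite ddE.
have e2 : (X j - X k) * h = g - act (tperm j k) g by rewrite ddE.
have := act_ddE (tperm i j) j k g; rewrite tpermR sk -/h act_dd // => e3.
have e4 : (X i - X j) * g = f - act (tperm i j) f by rewrite ddE.
have := act_ddE (tperm j k) i j f; rewrite tpermL ti -/g => e5.
have := act_ddE (tperm j k * tperm i j)%g i j f.
rewrite !permM ti !tpermL sk -/g => e6.
have aux (R : comNzRingType) (x y z d h1 h2 g1 g2 g3 f1 f2 f3 f4 f5 f6 : R) :
    (x - y) * d = h1 - h2 -> (y - z) * h1 = g1 - g2 -> (x - z) * h2 = g1 - g3 ->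
    (x - y) * g1 = f1 - f2 -> (x - z) * g2 = f3 - f4 -> (y - z) * g3 = f5 - f6 ->
    (x - y) * (y - z) * (x - z) * d = f1 - f2 - (f3 - f4) + (f5 - f6).
  move=> a1 a2 a3 a4 a5 a6; rewrite -a4 -a5 -a6.
  transitivity ((x - z) * ((y - z) * h1) - (y - z) * ((x - z) * h2)).
    transitivity ((y - z) * (x - z) * ((x - y) * d)); first by ring.
    by rewrite a1; ring.
  by rewrite a2 a3; ring.
apply: aux e1 e2 e3 e4 _ _; first by rewrite e5 actM.
by rewrite -actM e6 -actM mulgA.
Qed.

Lemma tperm_braid i j k : i != j -> j != k -> i != k ->
  (tperm i j * tperm j k * tperm i j = tperm j k * tperm i j * tperm j k)%g.
Proof.
move=> ij jk ik.
have -> : (tperm i j * tperm j k * tperm i j = tperm j k ^ tperm i j)%g.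
  by rewrite /conjg tpermV mulgA.
have -> : (tperm j k * tperm i j * tperm j k = tperm i j ^ tperm j k)%g.
  by rewrite /conjg tpermV mulgA.
by rewrite !tpermJ tpermL tpermR !tpermD // eq_sym.
Qed.

(** Reading [dd3E] for k, j, i gives the same alternating sum. The three sign changes of the
    Vandermonde product cancel those of the three reversed divided differences. *)
Lemma dd_braid i j k f : i != j -> j != k -> i != k ->
  dd i j (dd j k (dd i j f)) = dd j k (dd i j (dd j k f)).
Proof.
move=> ij jk ik; have [ji kj ki] : [/\ j != i, k != j & k != i] by split; rewrite eq_sym.
apply: (mulfI (mulf_neq0 (mulf_neq0 (subX_neq0 ij) (subX_neq0 jk)) (subX_neq0 ik))).
rewrite dd3E //; have := dd3E f kj ji ki.
rewrite (ddC _ jk) (ddC _ ij) (ddC _ jk) !(tpermC k j) !(tpermC j i).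
rewrite -(tperm_braid ij jk ik) => e.
have N (a b : 'I_n) (p : A) : a != b -> dd a b (- p) = - dd a b p.
  by move=> ab; rewrite -sub0r ddB // (dd_fix (f := 0)) ?rmorph0 ?sub0r.
move: e; rewrite !N // !opprK => e.
have aux (R : comNzRingType) (x y z d f0 f1 f2 f3 f4 f5 : R) :
    (z - y) * (y - x) * (z - x) * - d = f0 - f1 - (f2 - f3) + (f4 - f5) ->
    f0 - f2 - (f1 - f4) + (f3 - f5) = (x - y) * (y - z) * (x - z) * d.
  move=> a; transitivity (f0 - f1 - (f2 - f3) + (f4 - f5)); first by ring.
  by rewrite -a; ring.
exact: aux e.
Qed.

Section Adjoint.
Variables (Z : zmodType) (I : {additive A -> Z}).
Hypothesis I0 : forall i j f, i != j -> act (tperm i j) f = f -> I f = 0.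

(** The difference of the two arguments is symmetric in x_i and x_j: exchanging them replaces f by f
    - (x_i - x_j) d f, and g likewise, and the two extra terms (x_i - x_j) d f d g cancel. *)
Lemma adjoint_dd i j f g : i != j -> I (dd i j f * g) = I (f * dd i j g).
Proof.
move=> ij; apply/eqP; rewrite -subr_eq0 -raddfB /=; apply/eqP/(I0 ij).
rewrite rmorphB !rmorphM !act_dd //.
have -> : act (tperm i j) f = f - (X i - X j) * dd i j f by rewrite -ddE; ring.
have -> : act (tperm i j) g = g - (X i - X j) * dd i j g by rewrite -ddE; ring.
by ring.
Qed.
End Adjoint.

End DivDiffTheory.

Section DivDiffPoly.
Variable n : nat.
Local Notation P := {mpoly int[n]}.
Implicit Types (f g : P) (i j k l : 'I_n).

Lemma mpolyXU_inj : injective (fun i : 'I_n => 'X_i : P).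
Proof.
move=> i j /(congr1 (mcoeff U_(j)%MM)); rewrite !mcoeffXU eqxx.
by case: eqP.
Qed.

Let act (s : 'S_n) : {rmorphism P -> P} := msym s.
Let actM s t f : act (s * t)%g f = act t (act s f). Proof. exact: msymMm. Qed.
Let actX s i : act s 'X_i = 'X_(s i). Proof. exact: msymXU. Qed.
Let act1 f : act 1%g f = f. Proof. exact: msym1m. Qed.

Lemma divdiff_fix i j f : i != j -> msym (tperm i j) f = f -> divdiff i j f = 0.
Proof. exact: (dd_fix (act := act) mpolyXU_inj (@divdiffE n)). Qed.

Lemma msym_divdiff i j f : i != j -> msym (tperm i j) (divdiff i j f) = divdiff i j f.
Proof. exact: (act_dd actM act1 actX mpolyXU_inj (@divdiffE n)). Qed.

Lemma divdiffB i j f g : i != j -> divdiff i j (f - g) = divdiff i j f - divdiff i j g.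
Proof. exact: (ddB (act := act) mpolyXU_inj (@divdiffE n)). Qed.

Lemma divdiff_sum i j (I : Type) (r : seq I) (Q : pred I) (F : I -> P) : i != j ->
  divdiff i j (\sum_(a <- r | Q a) F a) = \sum_(a <- r | Q a) divdiff i j (F a).
Proof. exact: (dd_sum (act := act) mpolyXU_inj (@divdiffE n)). Qed.

Lemma divdiffXl i j f : i != j -> divdiff i j ('X_i * f) = f + 'X_j * divdiff i j f.
Proof. exact: (ddXl actX mpolyXU_inj (@divdiffE n)). Qed.

Lemma divdiffXr i j f : i != j -> divdiff i j ('X_j * f) = 'X_i * divdiff i j f - f.
Proof. exact: (ddXr actX mpolyXU_inj (@divdiffE n)). Qed.

Lemma divdiffXn i j k f : i != j -> k != i -> k != j ->
  divdiff i j ('X_k * f) = 'X_k * divdiff i j f.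
Proof. exact: (ddXn actX mpolyXU_inj (@divdiffE n)). Qed.

Lemma divdiff_comm i j k l f :
  i != j -> k != l -> i != k -> i != l -> j != k -> j != l ->
  divdiff i j (divdiff k l f) = divdiff k l (divdiff i j f).
Proof. exact: (dd_comm actM actX mpolyXU_inj (@divdiffE n)). Qed.

Lemma divdiff_braid i j k f : i != j -> j != k -> i != k ->
  divdiff i j (divdiff j k (divdiff i j f)) = divdiff j k (divdiff i j (divdiff j k f)).
Proof. exact: (dd_braid actM act1 actX mpolyXU_inj (@divdiffE n)). Qed.

Lemma integ_divdiff i j f g : i != j ->
  integ (divdiff i j f * g) = integ (f * divdiff i j g).
Proof.
exact: (adjoint_dd actM act1 actX mpolyXU_inj (@divdiffE n) (@integ_sym0 n int)).
Qed.

Lemma eqv_divdiff i j f g : i != j -> eqv f g -> eqv (divdiff i j f) (divdiff i j g).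
Proof.
move=> ij h r; rewrite [LHS](integ_divdiff f r ij) [RHS](integ_divdiff g r ij).
exact: h.
Qed.

(** Taking homogeneous parts commutes, up to a shift of degree, with multiplication by x_i - x_j.
    The product with the divided difference is homogeneous, and x_i - x_j is then cancelled. *)
Lemma divdiff_homog d i j f : i != j -> f \is d.+1.-homog -> divdiff i j f \is d.-homog.
Proof.
move=> ij hf; set g := divdiff i j f.
have piXm e m : pihomog (@mdeg n) e 'X_[m] = if (mdeg m == e)%N then 'X_[m] else 0 :> P.
  exact: pihomogX.
have piX k (p : P) : pihomog (@mdeg n) d.+1 ('X_k * p) = 'X_k * pihomog (@mdeg n) d p.
  elim/mpolyind: p => [|c m p _ _ IHp]; first by rewrite mulr0 !raddf0 mulr0.
  rewrite mulrDr !raddfD /= IHp mulrDr; congr (_ + _).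
  rewrite -scalerAr !linearZ /= -mpolyXD !piXm mdegD mdeg1 eqSS mpolyXD.
  by case: eqP => _; rewrite ?scaler0 ?mulr0 // -scalerAr.
rewrite homog_piE; apply/eqP/(mulfI (x := 'X_i - 'X_j)).
  by rewrite subr_eq0 (inj_eq mpolyXU_inj).
rewrite [LHS]mulrBl -!piX -[LHS]raddfB -mulrBl /= /g -divdiffE.
by apply: pihomog_dE; apply: rpredB => //; rewrite homog_piE -msym_pihomog pihomog_dE.
Qed.

End DivDiffPoly.

(** * Schubert polynomials *)

Section Noninv.
Variable n : nat.
Implicit Types (w v : 'S_n) (i j : 'I_n).

Definition noninv w : {set 'I_n * 'I_n} :=
  [set a : 'I_n * 'I_n | (a.1 < a.2)%N && (w a.1 < w a.2)%N].

Lemma adj_neq i j : j = i.+1 :> nat -> i != j.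
Proof. by move=> ji; rewrite -val_eqE /= ji neq_ltn ltnSn. Qed.

Lemma tperm_adj_lt i j x y : j = i.+1 :> nat -> (x, y) != (i, j) -> (x < y)%N ->
  (tperm i j x < tperm i j y)%N.
Proof.
move=> ji; rewrite xpair_eqE -!val_eqE /=.
by do 2![case: tpermP => [->|->|/eqP + /eqP +]; rewrite -?val_eqE /=]; lia.
Qed.

(** Applying the transposition to both positions maps the non-inversions of [tperm i j * w]
    bijectively onto those of w other than (i, j). *)
Lemma card_noninv_asc w i j : j = i.+1 :> nat -> (w i < w j)%N ->
  #|noninv w| = #|noninv (tperm i j * w)%g|.+1.
Proof.
move=> ji wij; pose t a := (tperm i j a.1, tperm i j a.2).
have tK : involutive t by move=> [x y]; rewrite /t !tpermK.
have -> : noninv w = (i, j) |: t @: noninv (tperm i j * w)%g.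
  apply/setP => -[x y]; rewrite !inE -[(x, y) in X in _ || X]tK (mem_imset _ _ (inv_inj tK)).
  rewrite !inE /t /= !permM !tpermK; have [[-> ->]|xy] := eqVneq (x, y) (i, j).
    by rewrite ji ltnSn wij.
  have [[-> ->]|yx] := eqVneq (x, y) (j, i).
    by rewrite tpermL tpermR ji ltnSn ltnNge leqnSn /= ltnNge ltnW.
  congr (_ && _); apply/idP/idP; first exact: tperm_adj_lt.
  move/(@tperm_adj_lt i j); rewrite !tpermK; apply => //.
  apply: contraNneq yx => -[e1 e2].
  by rewrite -[x](tpermK i j) -[y](tpermK i j) e1 e2 tpermL tpermR.
rewrite cardsU1 card_imset; last exact: inv_inj.
rewrite -[(i, j) in X in (X + _)%N]tK (mem_imset _ _ (inv_inj tK)) !inE /t /= tpermL tpermR.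
by rewrite ji ltnNge leqnSn.
Qed.
End Noninv.

Section SchubertRec.
Variable n : nat.
Local Notation P := {mpoly int[n]}.
Implicit Types (w v : 'S_n) (i j k l : 'I_n).

Lemma schubert_rec_fuel f w : (#|noninv w| <= f)%N ->
  schubert_rec f w = schubert_rec #|noninv w| w.
Proof.
have [m] := ubnP #|noninv w|; elim: m w f => // m IHm w f; rewrite ltnS => wm wf.
case: f wf => [|f]; first by rewrite leqn0 => /eqP->.
case e: #|noninv w| wm => [|k] wm wf /=.
  by case: pickP => [a /andP[/eqP ai wa]|_ //]; rewrite (card_noninv_asc ai wa) in e.
case: pickP => [a /andP[/eqP ai wa]|_]; last by reflexivity.
move: e; rewrite (card_noninv_asc ai wa) => -[e]; congr divdiff.
by rewrite IHm ?e.
Qed.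

Lemma schubert_step w : schubert w =
  if [pick a : 'I_n * 'I_n | (a.2 == a.1.+1 :> nat) && (w a.1 < w a.2)%N] is Some a
  then divdiff a.1 a.2 (schubert (tperm a.1 a.2 * w)%g) else 'X_[delta n].
Proof.
have cardle v : (#|noninv v| <= n * n)%N.
  by apply: leq_trans (max_card _) _; rewrite card_prod card_ord.
rewrite /schubert (schubert_rec_fuel (cardle w)).
case e: #|noninv w| => [|k] /=.
  by case: pickP => [a /andP[/eqP ai wa]|_ //]; rewrite (card_noninv_asc ai wa) in e.
case: pickP => [a /andP[/eqP ai wa]|_]; last by reflexivity.
move: e; rewrite (card_noninv_asc ai wa) => -[e]; congr divdiff.
by rewrite (schubert_rec_fuel (cardle _)) e.
Qed.

(** Independence of the chosen ascent. The ascent (i, j) is compared with the one (k, l) picked by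
    the recursion, by induction on the number of non-inversions: disjoint ascents unfold to
    commuting divided differences, overlapping ones to the two sides of the braid relation. *)
Lemma schubert_asc w i j : j = i.+1 :> nat -> (w i < w j)%N ->
  schubert w = divdiff i j (schubert (tperm i j * w)%g).
Proof.
have [m] := ubnP #|noninv w|; elim: m w i j => // m IHm w i j.
rewrite ltnS => wm ji wij; rewrite schubert_step.
case: pickP => [[k l]|/(_ (i, j))]; last by rewrite /= ji eqxx wij.
case/andP=> /eqP /= lk wkl.
have IH v i' j' : (#|noninv v| < #|noninv w|)%N -> j' = i'.+1 :> nat -> (v i' < v j')%N ->
    schubert v = divdiff i' j' (schubert (tperm i' j' * v)%g).
  by move=> ltv; apply: IHm; exact: leq_trans wm.
have ltn v i' j' : j' = i'.+1 :> nat -> (v i' < v j')%N ->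
    (#|noninv (tperm i' j' * v)%g| < #|noninv v|)%N.
  by move=> h1 h2; rewrite [X in (_ < X)%N](card_noninv_asc h1 h2).
have ij := adj_neq ji; have kl := adj_neq lk.
have adjacent i' j' l' : j' = i'.+1 :> nat -> l' = j'.+1 :> nat ->
    (w i' < w j')%N -> (w j' < w l')%N ->
    divdiff i' j' (schubert (tperm i' j' * w)%g) = divdiff j' l' (schubert (tperm j' l' * w)%g).
  move=> ji' lj' wij' wjl'; have ij' := adj_neq ji'; have jl' := adj_neq lj'.
  have il' : i' != l' by rewrite -val_eqE /=; lia.
  have wil' : (w i' < w l')%N by exact: ltn_trans wij' wjl'.
  have ei : tperm j' l' i' = i' by rewrite tpermD // eq_sym.
  have el : tperm i' j' l' = l' by rewrite tpermD // eq_sym.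
  have h1 : ((tperm i' j' * w)%g j' < (tperm i' j' * w)%g l')%N.
    by rewrite !permM tpermR el.
  have h2 : ((tperm j' l' * w)%g i' < (tperm j' l' * w)%g j')%N.
    by rewrite !permM tpermL ei.
  rewrite (IH _ _ _ (ltn _ _ _ ji' wij') lj' h1) (IH _ _ _ (ltn _ _ _ lj' wjl') ji' h2).
  have h3 : ((tperm j' l' * (tperm i' j' * w))%g i' < (tperm j' l' * (tperm i' j' * w))%g j')%N.
    by rewrite !permM tpermL ei el tpermL.
  have h4 : ((tperm i' j' * (tperm j' l' * w))%g j' < (tperm i' j' * (tperm j' l' * w))%g l')%N.
    by rewrite !permM tpermR ei el tpermR.
  rewrite (IH _ _ _ (ltn_trans (ltn _ _ _ lj' h1) (ltn _ _ _ ji' wij')) ji' h3).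
  rewrite (IH _ _ _ (ltn_trans (ltn _ _ _ ji' h2) (ltn _ _ _ lj' wjl')) lj' h4).
  rewrite !mulgA (tperm_braid ij' jl' il'); exact: divdiff_braid.
have [e|ik] := eqVneq i k.
  by rewrite -{}e in lk *; rewrite (_ : l = j) //; apply/val_inj; rewrite /= ji lk.
have [e|jk] := eqVneq j k.
  rewrite -{}e in lk wkl *; apply/esym; exact: adjacent ji lk wij wkl.
have [e|li] := eqVneq l i.
  rewrite {}e in lk wkl *; exact: adjacent lk ji wkl wij.
have jl : j != l by apply: contraNneq ik => e; rewrite -val_eqE -eqSS -ji -lk e.
have h1 : ((tperm k l * w)%g i < (tperm k l * w)%g j)%N.
  by rewrite !permM !tpermD // 1?eq_sym.
have h2 : ((tperm i j * w)%g k < (tperm i j * w)%g l)%N.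
  by rewrite !permM !tpermD // 1?eq_sym.
rewrite (IH _ _ _ (ltn _ _ _ lk wkl) ji h1) (IH _ _ _ (ltn _ _ _ ji wij) lk h2).
have [ki kj lj] : [/\ k != i, k != j & l != j] by split; rewrite eq_sym.
rewrite [LHS](divdiff_comm _ kl ij ki kj li lj).
rewrite !mulgA; rewrite (_ : tperm k l * tperm i j = tperm i j * tperm k l)%g //.
by rewrite conjgC tpermJ !tpermD // eq_sym.
Qed.

Lemma schubert_desc w i j : j = i.+1 :> nat -> (w j < w i)%N ->
  divdiff i j (schubert w) = schubert (tperm i j * w)%g.
Proof.
move=> ji wji; rewrite (schubert_asc (w := (tperm i j * w)%g) ji).
  by rewrite mulgA tperm2 mul1g.
by rewrite !permM tpermL tpermR.
Qed.

Lemma schubert_asc0 w i j : j = i.+1 :> nat -> (w i < w j)%N ->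
  divdiff i j (schubert w) = 0.
Proof.
move=> ji wij; have ij := adj_neq ji; rewrite (schubert_asc ji wij).
exact: divdiff_fix ij (msym_divdiff _ ij).
Qed.

Lemma longestE i : longest n i = rev_ord i.
Proof. by rewrite permE. Qed.

(** The values of w, read as exponents, are injective and bounded by delta, so [injective_le_delta]
    applies. *)
Lemma descents_longest w :
  (forall i j, j = i.+1 :> nat -> (w j < w i)%N) -> w = longest n.
Proof.
move=> hw; pose m := [multinom (w i : nat) | i < n].
have le_m i : (m i <= delta n i)%N.
  rewrite !mnmE; case: i => i; elim: i => [|i IHi] lti.
    by rewrite subn1 -ltnS prednK // (leq_trans _ lti).
  have := IHi (ltnW lti); have := hw (Ordinal (ltnW lti)) (Ordinal lti) erefl.
  by rewrite /=; lia.
have inj_m : injective m by move=> i j; rewrite !mnmE => /val_inj/perm_inj.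
apply/permP => i; apply/val_inj; rewrite longestE /=.
have /(congr1 (fun f : 'X_{1..n} => f i)) := injective_le_delta le_m inj_m.
by rewrite !mnmE.
Qed.

Lemma ascents_id w : (forall i j, j = i.+1 :> nat -> (w i < w j)%N) -> w = 1%g.
Proof.
move=> hw; have : (w * longest n)%g = longest n.
  apply: descents_longest => i j ji; rewrite !permM !longestE /=.
  by have := hw i j ji; have := ltn_ord (w j); lia.
by move=> e; apply: (mulIg (longest n)); rewrite mul1g.
Qed.

Lemma schubert_longest : schubert (longest n) = 'X_[delta n].
Proof.
rewrite schubert_step; case: pickP => [[i j]|] //= /andP[/eqP ji].
by rewrite !longestE /= ji; lia.
Qed.

Lemma card_noninv1 : #|noninv (1%g : 'S_n)| = mdeg (delta n).
Proof.
have -> : #|noninv (1%g : 'S_n)| = (\sum_(i < n) \sum_(j < n | i < j) 1)%N.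
  rewrite pair_big_dep -sum1_card; apply: eq_bigl => -[i j].
  by rewrite !inE /= !perm1 andbb.
rewrite mdegE; apply: eq_bigr => i _; rewrite mnmE.
rewrite -(big_mkord (fun j : nat => (i : nat) < j)%N (fun=> 1%N)).
have := big_nat_widenl i.+1 0 n xpredT (fun=> 1%N) (leq0n _) => /= <-.
by rewrite sum_nat_const_nat muln1.
Qed.

(** The degree is the number of inversions of w, written as a complement because the recursion runs
    on non-inversions. *)
Lemma schubert_homog w : schubert w \is (mdeg (delta n) - #|noninv w|).-homog.
Proof.
have [m] := ubnP #|noninv w|; elim: m w => // m IHm w; rewrite ltnS => wm.
have wle v : (#|noninv v| <= mdeg (delta n))%N.
  rewrite -card_noninv1; apply/subset_leq_card/subsetP => -[i j].
  by rewrite !inE /= !perm1 => /andP[->].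
rewrite schubert_step; case: pickP => [[i j]|].
  case/andP=> /eqP /= ji wij; apply: divdiff_homog; first exact: adj_neq.
  move: (wle w) wm; rewrite (card_noninv_asc ji wij) => wle' wm.
  by rewrite -subSn // subSS; apply: IHm.
move=> noasc; suff -> : w = longest n.
  rewrite (_ : #|_| = 0)%N ?subn0 ?dhomogX // .
  apply: eq_card0 => -[i j]; rewrite !inE /= !longestE /=.
  by have := ltn_ord j; lia.
apply: descents_longest => i j ji; have := noasc (i, j).
rewrite /= ji eqxx /= => /negbT; rewrite -leqNgt leq_eqVlt => /predU1P[/val_inj/perm_inj e|//].
by have := adj_neq ji; rewrite e eqxx.
Qed.

(** A permutation other than the identity has a descent, hence fewer non-inversions than the
    identity, and its Schubert polynomial has positive degree. *)
Lemma schubert_mcoeff0 w : w != 1%g -> (schubert w)@_0%MM = 0.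
Proof.
move=> w1; apply: dhomog_nemf_coeff (schubert_homog w) _.
rewrite -[X in X != _]/(mdeg 0%MM) mdeg0 eq_sym subn_eq0 -ltnNge.
have [[i j] /andP[/eqP /= ji wji]|nodesc] :=
    pickP [pred a : 'I_n * 'I_n | (a.2 == a.1.+1 :> nat) && (w a.2 < w a.1)%N].
  rewrite -card_noninv1; have := @card_noninv_asc n (tperm i j * w)%g i j ji.
  rewrite !permM tpermL tpermR mulgA tperm2 mul1g => /(_ wji) <-.
  apply/subset_leq_card/subsetP => -[k l].
  by rewrite !inE /= !perm1 => /andP[->].
case/eqP: w1; apply: ascents_id => i j ji; have := nodesc (i, j).
rewrite /= ji eqxx /= => /negbT; rewrite -leqNgt leq_eqVlt => /predU1P[/val_inj/perm_inj e|//].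
by have := adj_neq ji; rewrite e eqxx.
Qed.

End SchubertRec.

Ltac iflia := repeat case: ifP => [?|?]; lia.

(** * Duality of Schubert polynomials under the degree map *)

Section Duality.
Variable n : nat.
Local Notation P := {mpoly int[n]}.
Implicit Types (w v : 'S_n) (i j k l : 'I_n).

(* Moving the first entry d-1 of (d-1, .., 1, 0, d, .., n-1) to the right
   leads from the longest element down to the identity through permutations
   whose Schubert polynomials are monomials; (d, j) is the stage where d-1 has
   reached position j. *)
Lemma schubert_stage (d j : nat) w : (0 < d)%N -> (d <= n)%N -> (j < d)%N ->
    (forall i, w i = (if i < j then d - 2 - i else if i == j :> nat then d - 1
                      else if i < d then d - 1 - i else i)%N :> nat) ->
  schubert w = 'X_[[multinom (if i < j then d - 2 - i else d - 1 - i)%N | i < n]].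
Proof.
have [e] := ubnP (n - d); elim: e d j w => // e IHe d j w lte d0 dn.
elim: j w => [|j IHj] w jd hw.
  (* Stage (d, 0) is also stage (d + 1, d); for d = n it is the longest element. *)
  have [dn'|dn'] := ltnP d n.
    rewrite (IHe d.+1 d) //; first by congr 'X_[_]; apply/mnmP => i; rewrite !mnmE; iflia.
    - by lia.
    - by move=> i; rewrite hw; iflia.
  have <- : longest n = w.
    by apply/permP => i; apply/val_inj; rewrite longestE /= hw; have := ltn_ord i; iflia.
  by rewrite schubert_longest; congr 'X_[_]; apply/mnmP => i; rewrite !mnmE; iflia.
have jn : (j < n)%N by lia.
have jn1 : (j.+1 < n)%N by lia.
pose a := Ordinal jn; pose b := Ordinal jn1.
have ab : a != b by exact: adj_neq.
rewrite (@schubert_asc _ w a b) //; last by rewrite !hw /=; iflia.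
rewrite IHj; [|lia|]; last first.
  move=> i; rewrite permM; case: tpermP => [->|->|]; rewrite ?hw /=; try iflia.
  by move=> /eqP; rewrite -val_eqE /= => ia /eqP; rewrite -val_eqE /=; iflia.
(* In m both x_a and x_b have exponent d - 2 - j, so x^m is symmetric in them and the divided
   difference merely removes the extra factor x_a. *)
set m := [multinom (if i < j.+1 then _ else _)%N | i < n].
rewrite (_ : 'X_[_] = 'X_a * 'X_[m]); last first.
  rewrite -mpolyXD; congr 'X_[_]; apply/mnmP => i; rewrite mnmDE mnm1E !mnmE -val_eqE /=.
  by iflia.
rewrite (divdiffXl _ ab) (divdiff_fix ab) ?mulr0 ?addr0 // msymX tpermV.
congr 'X_[_]; apply/mnmP => i; rewrite !mnmE.
case: tpermP => [->|->|//] /=; iflia.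
Qed.

Lemma schubert1 : schubert (1%g : 'S_n) = 1.
Proof.
have [n0|n_gt0] := posnP n.
  have -> : (1%g : 'S_n) = longest n by apply/permP => i; have := ltn_ord i; iflia.
  rewrite schubert_longest (_ : delta n = 0%MM) ?mpolyX0 //.
  by apply/mnmP => i; have := ltn_ord i; iflia.
rewrite (@schubert_stage 1 0) //; last by move=> i; rewrite perm1; iflia.
by rewrite -mpolyX0; congr 'X_[_]; apply/mnmP => i; rewrite !mnmE; iflia.
Qed.

Lemma schubert_coeff0 w : (schubert w)@_0%MM = (w == 1%g)%:R.
Proof.
by have [->|/schubert_mcoeff0//] := eqVneq w 1%g; rewrite schubert1 mcoeff1 eqxx.
Qed.

Lemma ascent_ind (Q : 'S_n -> Prop) : Q (longest n) ->
    (forall v i j, j = i.+1 :> nat -> (v i < v j)%N -> Q (tperm i j * v)%g -> Q v) ->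
  forall v, Q v.
Proof.
move=> Q0 QS v; have [m] := ubnP #|noninv v|; elim: m v => // m IHm v.
rewrite ltnS => vm.
have [[i j] /andP[/eqP /= ji wij]|noasc] :=
    pickP [pred a : 'I_n * 'I_n | (a.2 == a.1.+1 :> nat) && (v a.1 < v a.2)%N].
  by apply: (QS _ i j) => //; apply: IHm; rewrite -(card_noninv_asc ji wij).
rewrite (_ : v = longest n) //; apply: descents_longest => i j ji.
have := noasc (i, j); rewrite /= ji eqxx /= => /negbT.
rewrite -leqNgt leq_eqVlt => /predU1P[/val_inj/perm_inj e|//].
by have := adj_neq ji; rewrite e eqxx.
Qed.

(** The divided differences that define S_v are moved one by one onto S_w. When v has become the
    longest element, x^delta extracts a constant term, which is nonzero only for the identity. *)
Lemma integ_schubert v w :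
  integ (schubert v * schubert w) = (v == w * longest n)%g%:R.
Proof.
elim/ascent_ind: v w => [w|v i j ji vij IHv w].
  rewrite schubert_longest integ_delta schubert_coeff0; congr (_ : bool)%:R.
  by rewrite -[X in _ = (X == _)]mul1g (inj_eq (mulIg _)) eq_sym.
rewrite (schubert_asc ji vij) integ_divdiff; last exact: adj_neq.
case: (ltngtP (w i) (w j)) => [wij|wji|/val_inj/perm_inj e].
(* Both sides vanish: v has an ascent at i, whereas [w * longest n] has a descent there. *)
- rewrite (schubert_asc0 ji wij) mulr0 raddf0.
  case: eqP => // e; move: vij; rewrite e !permM !longestE /=.
  by have := ltn_ord (w j); lia.
- rewrite (schubert_desc ji wji) IHv -mulgA; congr (_ : bool)%:R.
  by rewrite (inj_eq (mulgI _)).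
by have := adj_neq ji; rewrite e eqxx.
Qed.

End Duality.

(** * Monk's rule *)

Section Covers.
Variable n : nat.
Implicit Types (f g : 'I_n -> nat) (u w v : 'S_n) (i j k l : 'I_n).

(* Stated for functions, so that a cover of t * u is a cover of u composed with
   the transposition t. *)
Definition covf f k l : bool :=
  [&& (k < l)%N, (f k < f l)%N &
    [forall i : 'I_n, ~~ [&& (k < i)%N, (i < l)%N, (f k < f i)%N & (f i < f l)%N]]].

Lemma covfP f k l : reflect
  [/\ (k < l)%N, (f k < f l)%N &
    forall i, ~~ [&& (k < i)%N, (i < l)%N, (f k < f i)%N & (f i < f l)%N]]
  (covf f k l).
Proof. by apply: (iffP and3P) => -[? ? /forallP ?]. Qed.

Lemma covf_lt f k l : covf f k l -> (k < l)%N. Proof. by case/and3P. Qed.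

Lemma covf_flt f k l : covf f k l -> (f k < f l)%N. Proof. by case/and3P. Qed.

Lemma eq_covf f g : f =1 g -> covf f =2 covf g.
Proof.
move=> fg k l; rewrite /covf !fg; congr [&& _, _ & _].
by apply: eq_forallb => i; rewrite fg.
Qed.

Definition cov u := covf (fun x => nat_of_ord (u x)).

Lemma covP u k l : reflect
  [/\ (k < l)%N, (u k < u l)%N &
    forall i, ~~ [&& (k < i)%N, (i < l)%N, (u k < u i)%N & (u i < u l)%N]]
  (cov u k l).
Proof. exact: covfP. Qed.

Lemma cov_lt u k l : cov u k l -> (k < l)%N. Proof. exact: covf_lt. Qed.

(** Apart from the cover leading back up to v, the covers of the smaller permutation [tperm i j * v]
    correspond to the covers of v whose target still has a descent at i. These are the terms that
    the divided difference in x_i and x_j does not kill. *)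
Lemma cov_adj v i j a b : j = i.+1 :> nat -> (v j < v i)%N -> (a, b) != (j, i) ->
  cov (tperm i j * v)%g (tperm i j a) (tperm i j b) =
  cov v a b && ((tperm a b * v)%g j < (tperm a b * v)%g i)%N.
Proof.
move=> ji vji; rewrite xpair_eqE -!val_eqE /= => abji.
(* The permutation and both transpositions are replaced by functions known only through case
   distinctions on numbers, which leaves finitely many problems of linear arithmetic. *)
have [f [fE f_inj]] : exists f : 'I_n -> nat,
    (forall x, v x = f x :> nat) /\ injective f.
  by exists (fun x => nat_of_ord (v x)); split=> // x y /val_inj/perm_inj.
have [t [tK tE]] : exists t : 'I_n -> 'I_n, involutive t /\ forall x, tperm i j x = t x.
  by exists (tperm i j); split=> // x; rewrite tpermK.
have [s sE] : exists s : 'I_n -> 'I_n, forall x, tperm a b x = s x by exists (tperm a b).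
have tD (x : 'I_n) : [\/ [/\ x = i :> nat, t x = i.+1 :> nat & f x = f i],
    [/\ x = i.+1 :> nat, t x = i :> nat & f x = f j] |
    [/\ (x != i :> nat) && (x != i.+1 :> nat), t x = x :> nat & (f x != f i) && (f x != f j)]].
  rewrite -ji !val_eqE !(inj_eq f_inj) -tE; case: tpermP => [->|->|/eqP xi /eqP xj].
  - by apply: Or31.
  - by apply: Or32.
  - by apply: Or33; rewrite xi xj.
have sD (x : 'I_n) : [\/ x = a :> nat /\ s x = b, x = b :> nat /\ s x = a |
    (x != a :> nat) && (x != b :> nat) /\ s x = x].
  rewrite !val_eqE -sE; case: tpermP => [->|->|/eqP-> /eqP->].
  - by apply: Or31.
  - by apply: Or32.
  - by apply: Or33.
have ti : t i = i.+1 :> nat by rewrite -tE tpermL.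
have tj : t j = i :> nat by rewrite -tE tpermR.
move: vji; rewrite !fE => {}vji.
apply/idP/andP => [/covP[]|[/covP[]]]; rewrite !permM ?tpermK !fE ?tE => h1 h2 h3.
  have {}h3 x : ~~ [&& t a < t x, t x < t b, f a < f x & f x < f b]%N.
    by have := h3 (t x); rewrite permM tE tK fE.
  rewrite !sE; split; last first.
    move: (h3 i) (h3 j) h1; rewrite ti tj.
    case: (tD a) => -[ea -> fa]; case: (tD b) => -[eb -> fb];
    case: (sD i) => -[ei ->]; case: (sD j) => -[ej ->]; lia.
  apply/covP; rewrite !fE; split => // [|x].
    by move: h1; case: (tD a) => -[ea -> fa]; case: (tD b) => -[eb -> fb]; lia.
  rewrite fE; move: (h3 x) h1.
  by case: (tD a) => -[ea -> fa]; case: (tD b) => -[eb -> fb]; case: (tD x) => -[ex -> fx]; lia.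
rewrite !sE => h4; apply/covP; rewrite !permM !tE !tK !fE; split => //.
  move: h1.
  by case: (tD a) => -[ea -> fa]; case: (tD b) => -[eb -> fb]; lia.
move=> x; rewrite permM tE fE -{1 2}[x]tK; move: (t x) => y.
have := h3 y; rewrite fE.
move: h1 h4.
case: (tD a) => -[ea -> fa]; case: (tD b) => -[eb -> fb]; case: (tD y) => -[ey -> fy];
    case: (sD i) => -[ei ->]; case: (sD j) => -[ej ->]; lia.
Qed.

End Covers.

Section MonkOp.
Variables (n : nat) (V : zmodType) (G : 'S_n -> V).
Implicit Types (u w v : 'S_n) (i j k l : 'I_n).

(** The expansion of x_k S_u in Monk's rule, with an arbitrary G in place of the Schubert
    polynomials. *)
Definition monk k u : V :=
  \sum_(l | cov u k l) G (tperm k l * u)%g - \sum_(l | cov u l k) G (tperm l k * u)%g.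

Lemma cov_adjacent v i j : j = i.+1 :> nat -> (v i < v j)%N -> cov v i j.
Proof. by move=> ji vij; apply/covP; split=> [||x] //; lia. Qed.

Lemma tperm_conj v i j k l :
  (tperm (tperm i j k) (tperm i j l) * (tperm i j * v) = tperm i j * (tperm k l * v))%g.
Proof.
by rewrite -tpermJ /conjg tpermV -!mulgA [X in (_ * (_ * X))%g]mulgA tperm2 mul1g.
Qed.

(** [cov_adj] summed over one end of the cover. The cover excluded there, from [tperm i j * v] up to
    v, gives the extra term; the next lemma treats the other end. *)
Lemma sum_cov_adj_r v i j k : j = i.+1 :> nat -> (v j < v i)%N ->
  \sum_(l | cov (tperm i j * v)%g (tperm i j k) l)
     G (tperm (tperm i j k) l * (tperm i j * v))%g =
  \sum_(l | cov v k l && ((tperm k l * v)%g j < (tperm k l * v)%g i)%N)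
     G (tperm i j * (tperm k l * v))%g + (if k == j then G v else 0).
Proof.
move=> ji vji; rewrite (reindex_inj (@perm_inj _ (tperm i j))) /=.
under eq_bigr do rewrite tperm_conj.
rewrite (bigID (fun l => (k, l) == (j, i))) /= addrC; congr (_ + _).
  apply: eq_bigl => l; have [[-> ->]|kl] := eqVneq (k, l) (j, i); last first.
    by rewrite andbT cov_adj.
  by rewrite andbF; apply/esym/negbTE/negP => /andP[/cov_lt]; lia.
case: eqP => [->|/eqP kj]; last by rewrite big_pred0 // => l; rewrite xpair_eqE (negPf kj) andbF.
rewrite (big_pred1 i) => [|l]; last first.
  rewrite xpair_eqE eqxx /=; have [->|] := eqVneq l i; last by rewrite andbF.
  rewrite tpermL tpermR andbT; apply: cov_adjacent => //.
  by rewrite !permM tpermL tpermR.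
by rewrite tpermC mulgA tperm2 mul1g.
Qed.

Lemma sum_cov_adj_l v i j k : j = i.+1 :> nat -> (v j < v i)%N ->
  \sum_(l | cov (tperm i j * v)%g l (tperm i j k))
     G (tperm l (tperm i j k) * (tperm i j * v))%g =
  \sum_(l | cov v l k && ((tperm l k * v)%g j < (tperm l k * v)%g i)%N)
     G (tperm i j * (tperm l k * v))%g + (if k == i then G v else 0).
Proof.
move=> ji vji; rewrite (reindex_inj (@perm_inj _ (tperm i j))) /=.
under eq_bigr do rewrite tperm_conj.
rewrite (bigID (fun l => (l, k) == (j, i))) /= addrC; congr (_ + _).
  apply: eq_bigl => l; have [[-> ->]|kl] := eqVneq (l, k) (j, i); last first.
    by rewrite andbT cov_adj.
  by rewrite andbF; apply/esym/negbTE/negP => /andP[/cov_lt]; lia.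
case: eqP => [->|/eqP kj]; last by rewrite big_pred0 // => l; rewrite xpair_eqE (negPf kj) !andbF.
rewrite (big_pred1 j) => [|l]; last first.
  rewrite xpair_eqE eqxx andbT /=; have [->|] := eqVneq l j; last by rewrite andbF.
  rewrite tpermL tpermR andbT; apply: cov_adjacent => //.
  by rewrite !permM tpermL tpermR.
by rewrite tpermC mulgA tperm2 mul1g.
Qed.

End MonkOp.

Section Monk.
Variable n : nat.
Implicit Types (u w v : 'S_n) (i j k l : 'I_n).

Lemma divdiff_schubert x i j : j = i.+1 :> nat ->
  divdiff i j (schubert x) =
    if (x j < x i)%N then schubert (tperm i j * x)%g else 0 :> {mpoly int[n]}.
Proof.
move=> ji; case: ltngtP => [xji|xij|/val_inj/perm_inj e].
- exact: schubert_desc.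
- exact: schubert_asc0.
- by have := adj_neq ji; rewrite e eqxx.
Qed.

(** Downward induction. The longest element has no covers, and x_k x^delta is congruent to 0 because
    pairing it with r yields the constant term of x_k r. In the step the divided difference is
    applied to the congruence for v; its product rule on x_i S_v and x_j S_v produces terms S_v and
    - S_v, which the cover between u and v compensates. *)
Lemma monk_eqv k u : eqv (monk (@schubert n) k u) ('X_k * schubert u).
Proof.
elim/ascent_ind: u k => [|u i j ji uij IH] k.
  rewrite /monk !big_pred0 => [|l|l].
  - rewrite subrr schubert_longest => r; rewrite mul0r raddf0 -mulrA mulrCA integ_delta.
    by rewrite rmorphM /= mcoeffX mnm1_eq0 mul0r.
  - by apply/negbTE/covP => -[]; rewrite !longestE /=; lia.
  - by apply/negbTE/covP => -[]; rewrite !longestE /=; lia.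
have ij := adj_neq ji; set v := (tperm i j * u)%g in IH.
have vji : (v j < v i)%N by rewrite !permM tpermL tpermR.
have uE : u = (tperm i j * v)%g by rewrite mulgA tperm2 mul1g.
rewrite -[k](tpermK i j); move: (tperm i j k) => {}k.
have := eqv_divdiff ij (IH k).
rewrite /monk divdiffB // !divdiff_sum //.
rewrite (eq_bigr _ (fun l _ => divdiff_schubert _ ji)).
rewrite -big_mkcondr /=.
rewrite [X in _ - X](eq_bigr _ (fun l _ => divdiff_schubert _ ji)).
rewrite -big_mkcondr /= => h.
have mE : monk (@schubert n) (tperm i j k) u =
    \sum_(l | cov v k l && ((tperm k l * v)%g j <
                (tperm k l * v)%g i)%N)
       schubert (tperm i j * (tperm k l * v))%g -
    \sum_(l | cov v l k && ((tperm l k * v)%g j <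
                (tperm l k * v)%g i)%N)
       schubert (tperm i j * (tperm l k * v))%g +
    ((if k == j then schubert v else 0) - (if k == i then schubert v else 0)).
  rewrite /monk uE sum_cov_adj_r // sum_cov_adj_l //.
  by rewrite opprD addrACA.
have {h} := eqvD h (eqv_refl ((if k == j then schubert v else 0) -
  (if k == i then schubert v else 0))).
rewrite -mE => h; apply: eqv_trans h _.
have -> : schubert u = divdiff i j (schubert v) by rewrite schubert_desc // -uE.
case: tpermP => [->|->|/eqP ki /eqP kj].
- rewrite eqxx (negPf ij) sub0r divdiffXl // addrAC subrr add0r; exact: eqv_refl.
- rewrite eqxx eq_sym (negPf ij) subr0 divdiffXr // subrK; exact: eqv_refl.
rewrite (negPf ki) (negPf kj) subrr addr0 divdiffXn //; exact: eqv_refl.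
Qed.

End Monk.

(** * Commutation of Bruhat covers *)

Section CovFun.
Variable n : nat.
Implicit Types (f g : 'I_n -> nat) (a b c d i j k l p x : 'I_n).

(** Only the entries at a, b, c, d move, so only these must be rechecked for lying in between. *)
Lemma covf_disjoint f a b c d : injective f ->
    a != c -> a != d -> b != c -> b != d ->
  covf f a b -> covf (f \o tperm a b) c d -> covf f c d && covf (f \o tperm c d) a b.
Proof.
move=> f_inj ac ad bc bd /covfP[ab fab H1] /covfP[cd]; rewrite /= !tpermD // => fcd H2.
have fE (x y : 'I_n) : x != y -> (f x != f y) && (x != y :> nat).
  by move=> xy; rewrite (inj_eq f_inj) val_eqE xy.
have := fE _ _ ac; have := fE _ _ ad; have := fE _ _ bc; have := fE _ _ bd.
move: (H1 c) (H1 d) (H2 a) (H2 b); rewrite tpermL tpermR => Hc Hd Ha Hb na nb nc nd.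
apply/andP; split; apply/covfP; rewrite /= ?tpermD 1?eq_sym //; split=> // x.
  have := H2 x; case: tpermP => [->|->|_ _ //] _; lia.
have := H1 x; case: tpermP => [->|->|_ _ //] _; lia.
Qed.

Lemma covf_disjointE f a b c d : injective f ->
    a != c -> a != d -> b != c -> b != d ->
  covf f a b && covf (f \o tperm a b) c d = covf f c d && covf (f \o tperm c d) a b.
Proof.
move=> f_inj ac ad bc bd; apply/andP/andP => -[h1 h2]; apply/andP.
  exact: covf_disjoint.
by apply: covf_disjoint => //; rewrite eq_sym.
Qed.

(** At the positions p < k < l the entries are ordered as 213; the two sides are the chains to 321
    through 312 and through 231. *)
Lemma covf_three_last f p k l : injective f -> (p < k)%N -> (k < l)%N -> (f k < f p)%N ->
  covf f p l && covf (f \o tperm p l) k l = covf f k l && covf (f \o tperm k l) p k.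
Proof.
move=> f_inj pk kl fkp.
have fE x : x != p -> f x != f p by rewrite (inj_eq f_inj).
have out (c d x : 'I_n) : x <> c :> nat -> x <> d :> nat -> tperm c d x = x.
  by move=> xc xd; rewrite tpermD //; apply/eqP => e; [apply: xc|apply: xd]; rewrite e.
apply/andP/andP => -[/covfP[_ h1 H1] /covfP[_]]; rewrite /= ?tpermL ?tpermR => h2 H2;
  (split; apply/covfP; rewrite /= ?tpermL ?tpermR).
- split=> // [|x]; first by move: h2; rewrite out; lia.
  move: (H1 x) (H2 x) (fE x); rewrite -val_eqE /= [tperm p l k]out; try lia.
  by case: (ltngtP k x) => //= kx; case: (ltngtP x l) => //= xl; rewrite out; lia.
- rewrite out; try lia; split=> // x; move: (H1 x).
  by case: (ltngtP p x) => //= px; case: (ltngtP x k) => //= xk; rewrite out; lia.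
- rewrite out in h2; try lia.
  split=> // [|x]; first exact: ltn_trans kl.
  move: (H1 x) (H2 x); rewrite [tperm k l p]out; try lia.
  case: (ltngtP p x) => //= px; case: (ltngtP x l) => //= xl.
  case: (ltngtP x k) => //= [xk|kx|/val_inj->]; [rewrite out|..]; lia.
rewrite out in h2; try lia; rewrite out; try lia.
split=> // x; move: (H1 x).
by case: (ltngtP k x) => //= kx; case: (ltngtP x l) => //= xl; rewrite out; lia.
Qed.

(** At the positions a < k < j the entries are ordered as 123; the two sides are the chains to 312
    through 132 and through 213. *)
Lemma covf_three_first f a k j : injective f -> (a < k)%N -> (k < j)%N -> (f a < f k)%N ->
  covf f k j && covf (f \o tperm k j) a k = covf f a k && covf (f \o tperm a k) a j.
Proof.
move=> f_inj ak kj fak.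
have fE x : x != k -> f x != f k by rewrite (inj_eq f_inj).
have out (c d x : 'I_n) : x <> c :> nat -> x <> d :> nat -> tperm c d x = x.
  by move=> xc xd; rewrite tpermD //; apply/eqP => e; [apply: xc|apply: xd]; rewrite e.
apply/andP/andP => -[/covfP[_ h1 H1] /covfP[_]]; rewrite /= ?tpermL ?tpermR => h2 H2;
  (split; apply/covfP; rewrite /= ?tpermL ?tpermR).
- rewrite out in h2; try lia.
  split=> // x; move: (H2 x); rewrite [tperm k j a]out; try lia.
  by case: (ltngtP a x) => //= ax; case: (ltngtP x k) => //= xk; rewrite out; lia.
- rewrite out in h2; try lia; rewrite out; try lia.
  split=> // [|x]; first exact: ltn_trans kj.
  move: (H1 x) (H2 x); rewrite [tperm k j a]out; try lia.
  case: (ltngtP a x) => //= ax; case: (ltngtP x j) => //= xj.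
  case: (ltngtP x k) => //= [xk|kx|/val_inj->]; rewrite ?tpermR; try lia.
    by rewrite !out; lia.
  by rewrite out; lia.
- rewrite out in h2; try lia.
  split=> // x; move: (H2 x); rewrite [tperm a k j]out; try lia.
  by case: (ltngtP k x) => //= kx; case: (ltngtP x j) => //= xj; rewrite out; lia.
rewrite out in h2; try lia; rewrite out; try lia.
split=> // [|x]; first lia.
move: (H1 x) (H2 x) (fE x); rewrite -val_eqE /= [tperm a k j]out; try lia.
by case: (ltngtP a x) => //= ax; case: (ltngtP x k) => //= xk; rewrite !out; lia.
Qed.

(** The commutation relation for the covers exchanging k with a later position l holds term by term.
    After that exchange the value f p sits at t p, whence the relabelling on the right. The only
    case that is not a commutation at disjoint positions is j = l, which is [covf_three_last]. *)
Lemma covf_commute_last f p j k l (t := tperm k l) : injective f ->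
  [&& (p <= k)%N, (k < j)%N, covf f p j, covf (f \o tperm p j) k l
    & (f (tperm p j k) <= f p)%N] =
  [&& covf f k l, (f k < f p)%N, (t p < k)%N, (k <= t j)%N & covf (f \o t) (t p) (t j)].
Proof.
move=> f_inj; rewrite /t {t}.
have fE x y : x != y -> f x != f y by rewrite (inj_eq f_inj).
have out (c d x : 'I_n) : x <> c :> nat -> x <> d :> nat -> tperm c d x = x.
  by move=> xc xd; rewrite tpermD //; apply/eqP => e; [apply: xc|apply: xd]; rewrite e.
have [kl|lk] := ltnP k l; last first.
  by apply/and5P/and5P => -[] => [_ _ _ /covf_lt|/covf_lt] *; exfalso; lia.
have [pk|kp|/val_inj->] := ltngtP p k.
- rewrite [tperm k l p]out; try lia.
  have [jk|kj|/val_inj->] := ltngtP j k.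
  + by rewrite [tperm k l j]out; lia.
  + rewrite [tperm p j k]out; try lia.
    have fkp : f k != f p by apply: fE; rewrite -val_eqE /=; lia.
    have [/eqP|jl] := eqVneq (j : nat) l; last first.
      rewrite [tperm k l j]out; try lia.
      have := @covf_disjointE f p j k l f_inj; rewrite -!val_eqE /=.
      rewrite leq_eqVlt (negPf fkp) (ltnW kj) pk /= => E.
      have {E} : covf f p j && covf (f \o tperm p j) k l = covf f k l && covf (f \o tperm k l) p j.
        by apply: E; lia.
      move: (covf f p j) (covf (f \o _) k l) (covf f k l) (covf (f \o _) p j) (f k < f p)%N.
      by case=> [] [] [] [] [].
    rewrite val_eqE => /eqP->; rewrite tpermR.
    case: (ltngtP (f k) (f p)) fkp => // fkp _; rewrite ?andbF //.
    by rewrite pk leqnn !andbT /= covf_three_last.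
  + rewrite tpermL /=; apply/esym/negbTE/negP => /and5P[_ ? _ _ /covf_flt] /=.
    by rewrite tpermR out; lia.
- have -> : (tperm k l p < k)%N = false.
    by case: tpermP => [_|_|_ _]; lia.
  by rewrite !andbF.
by apply/and5P/and5P => -[];
    [move=> _ _ /covf_flt ? _; rewrite tpermL => *; exfalso; lia|move=> *; exfalso; lia].
Qed.

(** The counterpart for the covers exchanging k with an earlier position a; the overlapping case is
    now p = k, which is [covf_three_first]. *)
Lemma covf_commute_first f p j a k (t := tperm a k) : injective f ->
  [&& (p <= k)%N, (k < j)%N, covf f p j, covf (f \o tperm p j) a k
    & (f (tperm p j a) <= f p)%N] =
  [&& covf f a k, (f a < f p)%N, (t p < k)%N, (k <= t j)%N & covf (f \o t) (t p) (t j)].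
Proof.
move=> f_inj; rewrite /t {t}.
have fE x y : x != y -> f x != f y by rewrite (inj_eq f_inj).
have out (c d x : 'I_n) : x <> c :> nat -> x <> d :> nat -> tperm c d x = x.
  by move=> xc xd; rewrite tpermD //; apply/eqP => e; [apply: xc|apply: xd]; rewrite e.
have [ak|ka] := ltnP a k; last first.
  by apply/and5P/and5P => -[] => [_ _ _ /covf_lt|/covf_lt] *; exfalso; lia.
have [/eqP|pa] := eqVneq (p : nat) a.
  rewrite val_eqE => /eqP->.
  by apply/and5P/and5P => -[];
    [move=> _ _ /covf_flt ? _; rewrite tpermL => *; exfalso; lia|move=> *; exfalso; lia].
have [kp|pk] := ltnP k p.
  by rewrite [tperm a k p]out; lia.
have [jk|kj] := leqP j k.
  apply/and5P/and5P => -[]; first by move=> *; exfalso; lia.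
  have [->|ja] := eqVneq j a.
    rewrite tpermL => _ ? _ _ /covf_flt; rewrite /= tpermK tpermR.
    by move=> *; exfalso; lia.
  case: (tpermP a k j) ja => [->|->|_ /eqP]; rewrite ?eqxx // -?val_eqE /= => *; exfalso; lia.
rewrite [tperm a k j]out; try lia.
have [/eqP|pk'] := eqVneq (p : nat) k; last first.
  rewrite [tperm a k p]out; try lia; rewrite [tperm p j a]out; try lia.
  have fap : f a != f p by apply: fE; rewrite -val_eqE /=; lia.
  have := @covf_disjointE f p j a k f_inj; rewrite -!val_eqE /=.
  rewrite leq_eqVlt (negPf fap) (ltnW kj) [(p < k)%N]ltn_neqAle pk' pk /= => E.
  have {E} : covf f p j && covf (f \o tperm p j) a k = covf f a k && covf (f \o tperm a k) p j.
    by apply: E; lia.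
  move: (covf f p j) (covf (f \o _) a k) (covf f a k) (covf (f \o _) p j) (f a < f p)%N.
  by case=> [] [] [] [] [].
rewrite val_eqE => /eqP->; rewrite tpermR [tperm k j a]out; try lia.
have fak : f a != f k by apply: fE; rewrite -val_eqE /=; lia.
case: (ltngtP (f a) (f k)) fak => // fak _; rewrite ?andbF //.
by rewrite ak (ltnW kj) !andbT /= covf_three_first.
Qed.

End CovFun.

(** * Pieri's rule *)

Section SumSwap.
Variables (V : zmodType) (I J : finType).

Lemma sum_dep_swap (P : pred J) (Q : J -> pred I) (F : J -> I -> V) :
  \sum_(j | P j) \sum_(l | Q j l) F j l = \sum_l \sum_(j | P j && Q j l) F j l.
Proof. exact: exchange_big_dep. Qed.

Lemma sum_dep_cond (P : pred J) (Q : J -> pred I) (F : J -> I -> V) :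
  \sum_(j | P j) \sum_(l | Q j l) F j l = \sum_j \sum_(l | P j && Q j l) F j l.
Proof.
rewrite big_mkcond; apply: eq_bigr => j _.
by case: (P j); rewrite ?big_pred0_eq.
Qed.
End SumSwap.

Section EdgeOp.
Variables (n : nat) (V : zmodType).
Implicit Types (u w v : 'S_n) (i j k l p : 'I_n) (G H : 'S_n -> V) (b c : nat).

(* The edges labeled (k, b), for the cut c = k+1 into positions < c and >= c. *)
Definition edge_op c b G u : V :=
  \sum_(i : 'I_n | (i < c)%N && (u i == b :> nat)) \sum_(j : 'I_n | (c <= j)%N && cov u i j)
    G (tperm i j * u)%g.

(* The part of Monk's operator where the smaller of the two exchanged values is
   less than b. *)
Definition monk_lt k b G u : V :=
  \sum_(l | cov u k l && (u k < b)%N) G (tperm k l * u)%g -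
  \sum_(l | cov u l k && (u l < b)%N) G (tperm l k * u)%g.

Lemma cov_mulg (t u : 'S_n) : cov (t * u)%g =2 covf ((fun x => nat_of_ord (u x)) \o t).
Proof. by move=> a b; apply: eq_covf => x; rewrite permM. Qed.

Lemma edge_op_pos c G u p :
  edge_op c (u p) G u =
    \sum_(j : 'I_n | [&& (p < c)%N, (c <= j)%N & cov u p j]) G (tperm p j * u)%g.
Proof.
have eqp i : (u i == u p :> nat) = (i == p) by rewrite val_eqE (inj_eq perm_inj).
rewrite /edge_op; case: (ltnP p c) => pc /=.
  by rewrite (big_pred1 p) // => i; rewrite /= eqp; case: eqP => [->|]; rewrite ?pc ?andbF.
by rewrite !big_pred0 // => i; rewrite eqp; case: eqP => [->|]; rewrite ?andbF // ltnNge pc.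
Qed.

(** The commutation relation with b = u p, proved separately for the positive and the negative half
    of Monk's operator. On the right b has been moved by the first cover, so the sum over j is
    reindexed by that transposition. *)
Lemma edge_op_monk_lt k p u G :
  edge_op k.+1 (u p) (monk_lt k (u p).+1 G) u = monk_lt k (u p) (edge_op k (u p) G) u.
Proof.
have f_inj : injective (fun x => nat_of_ord (u x)) by move=> x y /val_inj/perm_inj.
have upE (t : 'S_n) : u p = (t * u)%g ((t^-1)%g p) by rewrite permM permKV.
rewrite edge_op_pos /monk_lt sumrB; congr (_ - _).
  rewrite sum_dep_swap [RHS](eq_bigr (fun l => \sum_(j : 'I_n | [&& (tperm k l p < k)%N,
      (k <= tperm k l j)%N & cov (tperm k l * u)%g (tperm k l p) (tperm k l j)])
      G (tperm k l * (tperm p j * u))%g)); last first.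
    move=> l _; rewrite {1}(upE (tperm k l)) edge_op_pos tpermV.
    rewrite (reindex_inj (@perm_inj _ (tperm k l))) /=.
    by apply: eq_bigr => j _; rewrite tperm_conj.
  rewrite [RHS]sum_dep_cond; apply: eq_bigr => l _; apply: eq_bigl => j.
  have := covf_commute_last p j k l f_inj.
  by rewrite !cov_mulg !permM !ltnS -!andbA => ->.
rewrite sum_dep_swap [RHS](eq_bigr (fun l => \sum_(j : 'I_n | [&& (tperm l k p < k)%N,
    (k <= tperm l k j)%N & cov (tperm l k * u)%g (tperm l k p) (tperm l k j)])
    G (tperm l k * (tperm p j * u))%g)); last first.
  move=> l _; rewrite {1}(upE (tperm l k)) edge_op_pos tpermV.
  rewrite (reindex_inj (@perm_inj _ (tperm l k))) /=.
  by apply: eq_bigr => j _; rewrite tperm_conj.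
rewrite [RHS]sum_dep_cond; apply: eq_bigr => l _; apply: eq_bigl => j.
have := covf_commute_first p j l k f_inj.
by rewrite !cov_mulg !permM !ltnS -!andbA => ->.
Qed.

(** This is E_b = D_b^k - D_b^(k-1). Moving the cut across position k gains the edges leaving k, if
    b sits there, and loses the edge arriving at k: these are the terms of Monk's operator with
    smaller value b. *)
Lemma edge_op_diff k p u G :
  edge_op k.+1 (u p) G u - monk_lt k (u p).+1 G u = edge_op k (u p) G u - monk_lt k (u p) G u.
Proof.
rewrite !edge_op_pos /monk_lt.
have eqp i : (u i == u p :> nat) = (i == p) by rewrite val_eqE (inj_eq perm_inj).
have -> : \sum_(l | cov u k l && (u k < (u p).+1)%N) G (tperm k l * u)%g =
   \sum_(l | cov u k l && (u k < u p)%N) G (tperm k l * u)%g +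
   (if p == k then \sum_(l | cov u k l) G (tperm k l * u)%g else 0).
  rewrite ltnS leq_eqVlt eqp eq_sym; case: eqP => [->|_] /=; last by rewrite addr0.
  rewrite ltnn [X in _ = X + _]big_pred0 ?add0r => [|l]; last by rewrite andbF.
  by apply: eq_bigl => l; rewrite andbT.
have -> : \sum_(l | cov u l k && (u l < (u p).+1)%N) G (tperm l k * u)%g =
   \sum_(l | cov u l k && (u l < u p)%N) G (tperm l k * u)%g +
   (if cov u p k then G (tperm p k * u)%g else 0).
  rewrite (bigID (fun l => u l < u p)%N) /=; congr (_ + _).
    by apply: eq_bigl => l; rewrite -andbA ltnS; case: (ltngtP (u l) (u p)).
  rewrite (eq_bigl (fun l => cov u l k && (l == p))) => [|l]; last first.
    by rewrite -andbA -leqNgt ltnS -eqn_leq eqp.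
  case: ifP => covpk; last first.
    by rewrite big_pred0 // => l; case: eqP => [->|]; rewrite ?covpk ?andbF.
  by rewrite (big_pred1 p) // => l /=; have [->|_] := eqVneq l p; rewrite ?covpk ?andbF.
have [pk|kp|/val_inj->] := ltngtP p k.
- have -> : \sum_(j : 'I_n | [&& true, (k <= j)%N & cov u p j]) G (tperm p j * u)%g =
    \sum_(j : 'I_n | [&& (p < k.+1)%N, (k < j)%N & cov u p j]) G (tperm p j * u)%g +
    (if cov u p k then G (tperm p k * u)%g else 0).
    rewrite ltnS (ltnW pk) (bigID (fun j => j == k)) /= addrC; congr (_ + _).
      by apply: eq_bigl => j; rewrite andbAC leq_ordD1.
    case: ifP => covpk; last first.
    by rewrite big_pred0 // => l; case: eqP => [->|]; rewrite ?covpk ?andbF.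
    by rewrite (big_pred1 k) // => l /=; have [->|_] := eqVneq l k; rewrite ?covpk ?leqnn ?andbF.
  rewrite -val_eqE (ltn_eqF pk) addr0 !opprB -[RHS]addrA; congr (_ + _).
  by rewrite [RHS]addrA [in RHS](addrC _ (\sum_(l | _) _)).
- have -> : cov u p k = false by apply/negP => /cov_lt; lia.
  by rewrite -val_eqE (gtn_eqF kp) !addr0 ltnS leqNgt kp /= !big_pred0_eq.
have -> : cov u k k = false by apply/negP => /cov_lt; lia.
have -> : \sum_(j : 'I_n | [&& (k < k.+1)%N, (k < j)%N & cov u k j]) G (tperm k j * u)%g =
    \sum_(l | cov u k l) G (tperm k l * u)%g.
  by apply: eq_bigl => j; rewrite ltnSn /=; apply: andb_idl => /cov_lt.
by rewrite eqxx addr0 big_pred0_eq sub0r !opprB addrC -addrA opprD -addrA addNr addr0.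
Qed.

End EdgeOp.

Section BlockOp.
Variables (n : nat) (R : comNzRingType).
Local Notation Q := {mpoly R[n]}.
Implicit Types (u w v : 'S_n) (i j k l p : 'I_n) (G H K : 'S_n -> Q) (b c m : nat) (y : R).

Definition step_op c y b G : 'S_n -> Q := fun u => G u + y *: edge_op c b G u.

(** The product of the 1 + y D_b for b < m at the cut c, with b = 0 outermost. *)
Definition block_op c y m G := foldr (step_op c y) G (iota 0 m).

Lemma edge_opD c b G H u :
  edge_op c b (fun v => G v + H v) u = edge_op c b G u + edge_op c b H u.
Proof. by rewrite /edge_op -big_split /=; apply: eq_bigr => i _; rewrite big_split. Qed.

Lemma edge_opZ c b a G u : edge_op c b (fun v => a * G v) u = a * edge_op c b G u.
Proof. by rewrite /edge_op mulr_sumr; apply: eq_bigr => i _; rewrite mulr_sumr. Qed.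

Lemma monk_ltD k b G H u :
  monk_lt k b (fun v => G v + H v) u = monk_lt k b G u + monk_lt k b H u.
Proof. by rewrite /monk_lt !big_split opprD addrACA. Qed.

Lemma monk_ltZ k b a G u : monk_lt k b (fun v => a * G v) u = a * monk_lt k b G u.
Proof. by rewrite /monk_lt mulrBr !mulr_sumr. Qed.

Lemma block_opS c y m G : block_op c y m.+1 G = block_op c y m (step_op c y m G).
Proof. by rewrite /block_op -[in LHS]addn1 iotaD foldr_cat. Qed.

(** With D^c for [edge_op c m] and M_b for [monk_lt k b], each step is (1 + y D^(k+1)) (1 - y
    M_(m+1)) = (1 - y M_m) (1 + y D^k): the terms in y agree by [edge_op_diff], those in y^2 by
    [edge_op_monk_lt]. The factor 1 - y M moves outward and disappears at M_0 = 0. *)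
Lemma block_op_monk_lt k y m G : (m <= n)%N ->
  block_op k.+1 y m (fun u => G u - y *: monk_lt k m G u) = block_op k y m G.
Proof.
elim: m G => [|m IHm] G mn.
  apply: functional_extensionality => u /=.
  by rewrite /block_op /= /monk_lt !big_pred0 ?subr0 ?scaler0 ?subr0 // => l; rewrite ltn0 andbF.
rewrite block_opS [RHS]block_opS -[RHS](IHm _ (ltnW mn)); congr block_op.
apply: functional_extensionality => u; rewrite /step_op.
have [p um] : exists p, u p = m :> nat.
  by exists ((u^-1)%g (Ordinal mn)); rewrite permKV.
have e1 := edge_op_monk_lt k p u G; have e2 := edge_op_diff k p u G.
rewrite um in e1 e2.
have monkN b (K : 'S_n -> Q) : monk_lt k b (fun v => K v + y *: edge_op k m K v) u =
    monk_lt k b K u + y *: monk_lt k b (edge_op k m K) u.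
  rewrite monk_ltD; congr (_ + _); rewrite -mul_mpolyC -monk_ltZ.
  by rewrite /monk_lt; congr (_ - _); apply: eq_bigr => l _; rewrite mul_mpolyC.
have edgeN (K K' : 'S_n -> Q) : edge_op k.+1 m (fun v => K v - y *: K' v) u =
    edge_op k.+1 m K u - y *: edge_op k.+1 m K' u.
  rewrite edge_opD; congr (_ + _); rewrite -mul_mpolyC -mulNr -edge_opZ.
  rewrite /edge_op; apply: eq_bigr => i _; apply: eq_bigr => j _.
  by rewrite mulNr mul_mpolyC.
have aux (V : lmodType R) (g m1 d1 x m0 d0 : V) : d1 - m1 = d0 - m0 ->
    g - y *: m1 + y *: (d1 - y *: x) = g + y *: d0 - y *: (m0 + y *: x).
  move=> e; rewrite scalerBr scalerDr opprD !addrA; congr (_ - _).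
  by rewrite -!addrA; congr (_ + _); rewrite addrC -!scalerBr e.
by rewrite edgeN monkN e1; apply: aux.
Qed.

Lemma monk_ltn k G u : monk_lt k n G u = monk G k u.
Proof. by congr (_ - _); apply: eq_bigl => l; rewrite ltn_ord andbT. Qed.

Lemma block_op_monk k y G :
  block_op k.+1 y n (fun u => G u - y *: monk G k u) = block_op k y n G.
Proof.
rewrite -[RHS](block_op_monk_lt _ _ _ (leqnn n)); congr block_op.
by apply: functional_extensionality => u; rewrite monk_ltn.
Qed.

Lemma block_op0 y m G : block_op 0 y m G = G.
Proof.
elim: m G => // m IHm G; rewrite block_opS IHm.
apply: functional_extensionality => u.
by rewrite /step_op /edge_op big_pred0 ?scaler0 ?addr0.
Qed.

Lemma block_opM c y m a G u : block_op c y m (fun v => a * G v) u = a * block_op c y m G u.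
Proof.
elim: m G u => // m IHm G u; rewrite !block_opS -IHm; congr (block_op _ _ _ _ _).
apply: functional_extensionality => v.
by rewrite /step_op edge_opZ mulrDr scalerAr.
Qed.

Lemma eqvZ a (p q : Q) : eqv p q -> eqv (a *: p) (a *: q).
Proof. by rewrite -!mul_mpolyC; exact: eqvMl. Qed.

Lemma eqv_block_op c y m G H u : (forall v, eqv (G v) (H v)) ->
  eqv (block_op c y m G u) (block_op c y m H u).
Proof.
elim: m G H u => [|m IHm] G H u GH; first exact: GH.
rewrite !block_opS; apply: IHm => v; apply: eqvD; first exact: GH.
by apply/eqvZ/eqv_sum => i _; apply/eqv_sum => j _; exact: GH.
Qed.

Lemma tail_prod0_eqv y : eqv (tail_prod n 0 y : Q) 1.
Proof.
have e : eqv (tail_prod n 0 y - 1 : Q) 0.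
  apply: eqv_sym0.
    apply/issymP => s; rewrite msymB msym1; congr (_ - _).
    by apply: msym_prod => // i _; rewrite msymB msym1 msymZ msymXU.
  rewrite mcoeffB mcoeff1 eqxx /tail_prod rmorph_prod /= big1 ?subrr // => i _.
  by rewrite mcoeffB mcoeffZ mcoeff1 mcoeffX mnm1_eq0 mulr0 subr0 eqxx.
by rewrite -[tail_prod n 0 y](subrK 1) -[X in eqv _ X]add0r; apply: eqvD.
Qed.

(* 1 - y x_k divides tail_prod n 0 y, which is congruent to 1. *)
Lemma eqv_cancel (k : 'I_n) y (p q : Q) :
  eqv ((1 - y *: 'X_k) * p) ((1 - y *: 'X_k) * q) -> eqv p q.
Proof.
move=> pq; have e (r : Q) : eqv (tail_prod n 0 y * r) r.
  by rewrite -[X in eqv _ X]mul1r; apply: eqvM => //; exact: tail_prod0_eqv.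
apply: eqv_trans (eqv_sym (e p)) (eqv_trans _ (e q)).
rewrite /tail_prod (bigD1 k) //= -!mulrA ![_ * (\prod_(i | _) _ * _)]mulrCA.
exact: eqvMl.
Qed.

(* Modulo the symmetric polynomials without constant term, tail_prod n k y is the
   generating function of the complete symmetric polynomials in the first k
   variables. *)
Lemma block_op_pieri (k : nat) y G u :
    (forall i v, eqv (monk G i v) ('X_i * G v)) -> (k <= n)%N ->
  eqv (block_op k y n G u) (tail_prod n k y * G u).
Proof.
move=> hG; elim: k => [_|k IHk kn].
  rewrite block_op0 -{1}[G u]mul1r; apply: eqvM => //.
  exact/eqv_sym/tail_prod0_eqv.
(* Multiplied by 1 - y x_k, the right-hand side for k + 1 becomes the one for k. On the left this
   factor enters the block, where Monk's congruence turns it into 1 - y [monk], and [block_op_monk]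
   lowers the cut. *)
apply: (@eqv_cancel (Ordinal kn) y).
rewrite mulrA -(tail_prodS (Ordinal kn)) -block_opM.
apply: eqv_trans (IHk (ltnW kn)); rewrite -(block_op_monk (Ordinal kn)).
apply: eqv_block_op => v; rewrite mulrBl mul1r -scalerAl.
by apply: eqvB => //; apply/eqvZ/eqv_sym/hG.
Qed.

Definition full_op (y : nat -> R) m G :=
  foldr (fun k : nat => block_op k.+1 (y k) n) G (iota 0 m).

Lemma full_opS (y : nat -> R) m G : full_op y m.+1 G = full_op y m (block_op m.+1 (y m) n G).
Proof. by rewrite /full_op -[in LHS]addn1 iotaD foldr_cat. Qed.

Lemma full_op_eqv (y : nat -> R) m G H u : (forall v, eqv (G v) (H v)) ->
  eqv (full_op y m G u) (full_op y m H u).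
Proof.
elim: m G H u => [|m IHm] G H u GH; first exact: GH.
by rewrite !full_opS; apply: IHm => v; apply: eqv_block_op.
Qed.

Lemma full_opM (y : nat -> R) m a G u : full_op y m (fun v => a * G v) u = a * full_op y m G u.
Proof.
elim: m G u => // m IHm G u; rewrite !full_opS -IHm; congr (full_op _ _ _ _).
by apply: functional_extensionality => v; rewrite block_opM.
Qed.

(** The innermost block is replaced by multiplication with a polynomial, which commutes with the
    remaining blocks. *)
Lemma full_op_kernel (y : nat -> R) G u :
    (forall i v, eqv (monk G i v) ('X_i * G v)) ->
  eqv (full_op y n G u) (kernel (fun k : 'I_n => y k) * G u).
Proof.
move=> hG; rewrite /kernel; have [m mn] := (ex_intro (fun m => m <= n)%N n (leqnn n)).
suff : forall m, (m <= n)%N ->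
    eqv (full_op y m G u) ((\prod_(k < m) tail_prod n k.+1 (y k)) * G u) by apply.
move=> {m mn}; elim => [_|m IHm mn]; first by rewrite big_ord0 mul1r.
rewrite full_opS big_ord_recr /= mulrAC [X in eqv _ X]mulrC.
apply: eqv_trans (full_op_eqv _ _ _ (fun v => block_op_pieri (y m) v hG mn)) _.
by rewrite full_opM; apply/eqvMl/IHm/ltnW.
Qed.

End BlockOp.

(** * Increasing chains *)

Section Chains.
Variable n : nat.
Implicit Types (u w v : 'S_n) (L : seq (label n)) (l : label n) (g : seq (step n)).

(** Each label of L is skipped or used once, just as a factor 1 + y D contributes its 1 or its y
    D. *)
Fixpoint chains L u : seq (seq (step n)) :=
  if L is l :: L' then
    chains L' u ++ [seq (l, v) :: g | v <- enum (labeled_edge u l), g <- chains L' v]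
  else [:: [::]].

Definition chain_end u g := last u [seq e.2 | e <- g].

Lemma mem_chains L u g :
  (g \in chains L u) = subseq [seq e.1 | e <- g] L && is_chain u g (chain_end u g).
Proof.
rewrite /chain_end; elim: L u g => [|l L IHL] u [|[l' v] g] /=.
- by rewrite inE !eqxx.
- by rewrite inE.
- rewrite mem_cat IHL /= sub0seq eqxx.
  by rewrite orb_idr // => /allpairsPdep[? [? []]].
rewrite mem_cat IHL /=; case: eqP => [->|ll'].
  have -> : ((l, v) :: g \in [seq (l, v0) :: g0 | v0 <- enum (labeled_edge u l), g0 <- chains L v0])
     = labeled_edge u l v && (g \in chains L v).
    apply/allpairsPdep/andP => [[v' [g' []]]|[h1 h2]].
      by rewrite mem_enum => h1 h2 [-> ->].
    by exists v, g; rewrite mem_enum.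
  rewrite IHL orb_idl; first by rewrite andbCA.
  case/andP=> h /andP[-> ->]; rewrite andbT.
  exact: subseq_trans (subseq_cons _ _) h.
rewrite orb_idr // => /allpairsPdep[v' [g' [_ _ [e _ _]]]].
by case: ll'; rewrite e.
Qed.

Lemma chains_uniq L u : uniq L -> uniq (chains L u).
Proof.
elim: L u => //= l L IHL u /andP[lL uL]; rewrite cat_uniq IHL //=; apply/andP; split.
  apply/hasPn => _ /allpairsPdep[v [g [_ _ ->]]]; rewrite mem_chains /=.
  apply: contraNN lL => /andP[/mem_subseq h _]; apply: h.
  by rewrite inE eqxx.
apply: allpairs_uniq_dep => [|v _|]; [exact: enum_uniq|exact: IHL|].
by move=> [v g] [v' g'] _ _ /= [-> ->].
Qed.

Definition all_labels : seq (label n) := [seq (k, b) | k <- enum 'I_n, b <- enum 'I_n].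

Lemma mem_all_labels l : l \in all_labels.
Proof. by apply/allpairsP; exists l; rewrite !mem_enum; case: l. Qed.

Lemma all_labels_uniq : uniq all_labels.
Proof. by apply: allpairs_uniq; rewrite ?enum_uniq // => -[? ?] [? ?]. Qed.

Lemma label_lt_trans : transitive (@label_lt n).
Proof.
move=> [a b] [c d] [e f]; rewrite /label_lt /= -!val_eqE /=.
by case/orP=> [h1|/andP[/eqP h1 h1']]; case/orP=> [h2|/andP[/eqP h2 h2']]; lia.
Qed.

Lemma label_lt_irr : irreflexive (@label_lt n).
Proof. by move=> [a b]; rewrite /label_lt /= !ltnn andbF. Qed.

Lemma all_labels_sorted : sorted (@label_lt n) all_labels.
Proof.
have sortI : sorted (fun i j : 'I_n => i < j)%N (enum 'I_n).
  by have := iota_ltn_sorted 0 n; rewrite -val_enum_ord sorted_map.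
have ltn_ord_trans : transitive (fun i j : 'I_n => i < j)%N by move=> ? ? ?; exact: ltn_trans.
rewrite (sorted_pairwise label_lt_trans) /all_labels.
move: sortI; rewrite (sorted_pairwise ltn_ord_trans); move: (enum 'I_n) => t sort_t.
suff h (s : seq 'I_n) : pairwise (fun i j : 'I_n => i < j)%N s ->
    pairwise (@label_lt n) [seq (k, b) | k <- s, b <- t] by exact: h.
elim: s => //= k s IHs /andP[ks sort_s].
rewrite pairwise_cat IHs // andbT pairwise_map; apply/andP; split; last first.
  by apply: sub_pairwise sort_t => b b' /= bb'; rewrite /label_lt /= eqxx bb' orbT.
apply/allrelP => _ _ /mapP[b _ ->] /allpairsP[[k' b'] [/= k's _ ->]].
by rewrite /label_lt /= (allP ks).
Qed.

(** The strictly increasing lists of labels are exactly the subsequences of the sorted list of all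
    labels. *)
Lemma increasing_chainE u g w :
  increasing_chain u g w = (g \in chains all_labels u) && (chain_end u g == w).
Proof.
have endE : is_chain u g w -> chain_end u g = w.
  rewrite /chain_end; elim: g u => [|[l v] g IHg] u /=; first by move/eqP.
  by case/andP => _ /IHg.
have subE : increasing g = subseq [seq e.1 | e <- g] all_labels.
  rewrite /increasing; apply/idP/idP => [sg|/subseq_sorted]; last first.
    by apply; [exact: label_lt_trans|exact: all_labels_sorted].
  suff <- : [seq l <- all_labels | l \in [seq e.1 | e <- g]] = [seq e.1 | e <- g].
    exact: filter_subseq.
  apply: (irr_sorted_eq label_lt_trans label_lt_irr) => //.
    by apply: sorted_filter all_labels_sorted; exact: label_lt_trans.
  by move=> l; rewrite mem_filter mem_all_labels andbT.
rewrite /increasing_chain subE mem_chains andbC; apply/idP/idP.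
  by case/andP=> -> h; rewrite (endE h) h eqxx.
by case/andP=> /andP[-> h] /eqP <-.
Qed.

Lemma sum_increasing_chains (V : nmodType) u w (F : seq (step n) -> V) :
  \sum_(g : {bseq n * n of step n} | increasing_chain u g w) F g =
  \sum_(g <- chains all_labels u | chain_end u g == w) F g.
Proof.
rewrite -[LHS]big_filter -[RHS]big_filter.
rewrite -[LHS](big_map (fun g : {bseq n * n of step n} => g : seq (step n)) xpredT F).
apply: perm_big; apply: uniq_perm; rewrite ?filter_uniq ?chains_uniq ?all_labels_uniq //.
  by rewrite map_inj_uniq ?filter_uniq ?index_enum_uniq //; exact: val_inj.
move=> g; rewrite mem_filter andbC -increasing_chainE; apply/mapP/idP => [[h]|hg].
  by rewrite mem_filter => /andP[hh _] ->.
exists (Bseq (increasing_chain_size hg)) => //.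
by rewrite mem_filter hg mem_index_enum.
Qed.

End Chains.

Section EdgeSum.
Variables (n : nat) (V : zmodType).
Implicit Types (u w v : 'S_n) (k b i j p : 'I_n) (G : 'S_n -> V).

Lemma bruhat_cover_tperm u p j : (p < j)%N -> bruhat_cover u (tperm p j * u)%g = cov u p j.
Proof.
move=> pj; apply/existsP/idP => [[k /existsP[l /and4P[kl /eqP e ukl /forallP h]]]|/covP[_ upj h]].
  have {}e : tperm p j = tperm k l by apply: (mulIg u).
  have kp : k = p.
    have := congr1 (fun s : 'S_n => s k) e; rewrite /= tpermL; case: tpermP => [//|kj|_ _] lE.
      by move: kl; rewrite kj -lE => /(ltn_trans pj); rewrite ltnn.
    by move: kl; rewrite -lE ltnn.
  have lj : l = j.
    have := congr1 (fun s : 'S_n => s k) e; rewrite /= tpermL {1}kp tpermL.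
    by [].
  by apply/covP; rewrite -kp -lj; split=> // i; exact: h.
exists p; apply/existsP; exists j; rewrite pj eqxx upj /=.
by apply/forallP.
Qed.

Lemma labeled_edge_tperm u k p j : labeled_edge u (k, u p) (tperm p j * u)%g =
  [&& (p < k.+1)%N, (k < j)%N & cov u p j].
Proof.
rewrite ltnS; apply/andP/and3P => [[h /existsP[i /existsP[j' /and5P[/eqP e ik kj /eqP /= up _]]]]|
  [pk kj h]].
  move/perm_inj: up => up; rewrite -{i}up in e ik *; rewrite mulgK in e.
  have jE : j = j' by have := congr1 (fun s : 'S_n => s p) e; rewrite /= !tpermL.
  rewrite -{}jE /= in kj; rewrite -(bruhat_cover_tperm u (leq_ltn_trans ik kj)).
  by split.
have pj : (p < j)%N := leq_ltn_trans pk kj.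
rewrite bruhat_cover_tperm //; split=> //; apply/existsP; exists p; apply/existsP; exists j.
by rewrite mulgK /= eqxx pk kj permM tpermR !eqxx.
Qed.

Lemma labeled_edgeE u k p v : labeled_edge u (k, u p) v -> v = (tperm p ((v^-1)%g (u p)) * u)%g.
Proof.
case/andP => _ /existsP[i /existsP[j /and5P[/eqP e _ _ /eqP /= up /eqP uv]]].
rewrite uv permK (perm_inj up) -e mulgKV //.
Qed.

(** The target v of an edge labeled (k, b) is determined by the position of b in v, which serves to
    reindex the sum. *)
Lemma sum_labeled_edge k b u G : \sum_(v | labeled_edge u (k, b) v) G v = edge_op k.+1 b G u.
Proof.
have -> : b = u ((u^-1)%g b) by rewrite permKV.
move: ((u^-1)%g b) => p; rewrite edge_op_pos.
rewrite (reindex_onto (fun j => tperm p j * u)%g (fun v => (v^-1)%g (u p))) /=; last first.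
  by move=> v /labeled_edgeE <-.
apply: eq_bigl => j; rewrite labeled_edge_tperm invMg permM permK tpermV tpermL eqxx andbT.
by [].
Qed.
End EdgeSum.

Section ChainSum.
Variables (n : nat) (R : comNzRingType).
Implicit Types (u w v : 'S_n) (l : label n) (L : seq (label n)) (y : nat -> R).

Definition label_op y l (G : 'S_n -> {mpoly R[n]}) u : {mpoly R[n]} :=
  G u + y l.1 *: \sum_(v | labeled_edge u l v) G v.

Lemma label_opE y k b G : label_op y (k, b) G = step_op k.+1 (y k) b G.
Proof.
by apply: functional_extensionality => u; rewrite /label_op /step_op /= sum_labeled_edge.
Qed.

(** The nesting of the blocks, k outside and b inside, is the lexicographic order of the labels. *)
Lemma full_op_labels y G : full_op y n G = foldr (label_op y) G (all_labels n).
Proof.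
have blockE (k : 'I_n) (H : 'S_n -> {mpoly R[n]}) : block_op k.+1 (y k) n H =
    foldr (label_op y) H [seq (k, b) | b <- enum 'I_n].
  rewrite /block_op -val_enum_ord foldr_map.
  suff h (s : seq 'I_n) : foldr (fun b : 'I_n => step_op k.+1 (y k) b) H s =
    foldr (label_op y) H [seq (k, b) | b <- s] by exact: h.
  by elim: s => //= b s ->; rewrite label_opE.
rewrite /full_op -val_enum_ord foldr_map /all_labels.
move: (enum 'I_n) (blockE) => t {}blockE.
suff h (s : seq 'I_n) : foldr (fun (k : 'I_n) z => block_op k.+1 (y k) n z) G s =
  foldr (label_op y) G [seq (k, b) | k <- s, b <- t] by exact: h.
by elim: s => //= k s ->; rewrite foldr_cat blockE.
Qed.

Lemma foldr_label_op y G L u : foldr (label_op y) G L u =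
  \sum_(g <- chains L u) (\prod_(e <- g) y e.1.1) *: G (chain_end u g).
Proof.
elim: L u => [|l L IHL] u /=; first by rewrite big_seq1 big_nil scale1r.
rewrite /label_op IHL big_cat /=; congr (_ + _).
rewrite big_allpairs_dep big_enum /= scaler_sumr; apply: eq_big => v // _.
rewrite IHL scaler_sumr; apply: eq_bigr => g _.
by rewrite scalerA big_cons.
Qed.

Definition mpoly_intr : {mpoly int[n]} -> {mpoly R[n]} := map_mpoly intr.

HB.instance Definition _ := GRing.RMorphism.on mpoly_intr.

Lemma liftX m : mpoly_intr 'X_[m] = 'X_[m].
Proof. by rewrite /mpoly_intr map_mpolyX. Qed.

Lemma integ_lift p : integ (mpoly_intr p) = (integ p)%:~R.
Proof.
rewrite /integ rmorph_sum; apply: eq_bigr => s _.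
by rewrite mcoeff_map_mpoly rmorphM rmorph_sign.
Qed.

Lemma eqv_monomials (p q : {mpoly R[n]}) :
  (forall m, integ (p * 'X_[m]) = integ (q * 'X_[m])) -> eqv p q.
Proof.
move=> pq r; elim/mpolyind: r => [|c m r _ _ IHr]; first by rewrite !mulr0.
by rewrite !mulrDr !raddfD /= IHr -!scalerAr !linearZ /= pq.
Qed.

(** Congruence over R need only be tested on monomials, and these come from integral polynomials. *)
Lemma eqv_lift p q : eqv p q -> eqv (mpoly_intr p) (mpoly_intr q).
Proof.
move=> pq; apply: eqv_monomials => m; rewrite -(liftX m).
by rewrite -[mpoly_intr p * _]rmorphM -[mpoly_intr q * _]rmorphM !integ_lift pq.
Qed.

Lemma monk_lift k u :
  eqv (monk (fun v => mpoly_intr (schubert v)) k u) ('X_k * mpoly_intr (schubert u)).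
Proof.
rewrite -liftX -rmorphM; apply: eqv_trans (eqv_lift (monk_eqv k u)).
by rewrite /monk rmorphB !rmorph_sum; exact: eqv_refl.
Qed.

Lemma longestK : (longest n * longest n = 1)%g.
Proof. by apply/permP => i; rewrite permM perm1 !longestE rev_ordK. Qed.

Lemma sum_chains_integ y u w :
  \sum_(g : {bseq n * n of step n} | increasing_chain u g w) \prod_(e <- g) y e.1.1 =
  integ (kernel (fun k : 'I_n => y k) *
         mpoly_intr (schubert u * schubert (w * longest n)%g)).
Proof.
rewrite (sum_increasing_chains u w (fun g => \prod_(e <- g) y e.1.1)) rmorphM mulrA.
rewrite -(full_op_kernel y u monk_lift) full_op_labels foldr_label_op.
rewrite mulr_suml raddf_sum /= big_mkcond /=; apply: eq_bigr => g _.
rewrite -scalerAl linearZ /= -rmorphM integ_lift integ_schubert -mulgA longestK mulg1.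
by case: eqP => _; rewrite ?mulr1 ?mulr0.
Qed.

End ChainSum.

(** * Reduction modulo the ideal *)

Section Reduction.
Variable n : nat.
Local Notation P := {mpoly int[n]}.
Local Notation I := (@coinv_ideal n).
Implicit Types (p q r : P) (m : 'X_{1..n}) (i j k l : 'I_n).

Lemma coinv_eqv p : p \in I -> eqv p 0.
Proof.
case/coinv_idealP => c ->; apply: (@eqv_trans _ _ (\sum_(i < n) c i * 0)); last first.
  by rewrite big1 // => i _; rewrite mulr0.
apply: eqv_sum => i _; apply/eqvMl/eqv_sym0; first exact: mesym_sym.
by rewrite mcoeff_mesym /mechar mdeg0.
Qed.

Lemma coinvM p q : q \in I -> p * q \in I.
Proof. exact: idealMr. Qed.

Lemma mesym_coinv d : (0 < d)%N -> mesym n int d \in I.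
Proof.
case: d => // d _; have [dn|nd] := ltnP d n; last by rewrite mesym_geqnE ?rpred0.
apply/coinv_idealP; exists (fun i => (i == Ordinal dn)%:R).
rewrite (bigD1 (Ordinal dn)) //= eqxx mul1r big1 ?addr0 // => i /negPf->.
by rewrite mul0r.
Qed.

(** The default 0 for k >= n makes variables indexed by natural numbers available to recursions on
    k. *)
Definition nvar (k : nat) : P := if insub k is Some i then 'X_i else 0.

Lemma nvarE i : nvar i = 'X_i.
Proof. by rewrite /nvar valK. Qed.

(** The complete homogeneous symmetric polynomial of degree d in the first k variables, expanded by
    the exponent of the last of them. *)
Fixpoint hsym (k d : nat) : P :=
  if k is k'.+1 then \sum_(j < d.+1) nvar k' ^+ j * hsym k' (d - j) else (d == 0%N)%:R.

(* Up to the sign (-1)^d, the elementary symmetric polynomial of degree d in the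
   variables of index at least k. *)
Definition esym_tail (k d : nat) : P :=
  (\prod_(i < n | (k <= i)%N) (1 - ('X_i)%:P * 'X : {poly P}))`_d.

Lemma hsym0 (k : nat) : hsym k 0 = 1.
Proof. by elim: k => //= k IHk; rewrite big_ord1 mul1r. Qed.

Lemma hsymS (k d : nat) : hsym k.+1 d.+1 = hsym k d.+1 + nvar k * hsym k.+1 d.
Proof.
rewrite /= big_ord_recl mul1r subn0 mulr_sumr; congr (_ + _).
by apply: eq_bigr => j _; rewrite exprS mulrA.
Qed.

Lemma esym_tailS k d :
  esym_tail k d.+1 = esym_tail k.+1 d.+1 - 'X_k * esym_tail k.+1 d.
Proof.
rewrite /esym_tail (bigD1 k) //= (eq_bigl (fun i : 'I_n => k < i)%N _ (leq_ordD1 k)).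
by rewrite mulrBl mul1r coefB -mulrA coefCM coefXM.
Qed.

Lemma esym_tail_at0 (k : nat) : esym_tail k 0 = 1.
Proof.
rewrite /esym_tail coef0_prod big1 // => i _.
by rewrite coefB coef1 coefMX subr0.
Qed.

Lemma esym_tail_gt (k d : nat) : (k <= n)%N -> (n - k < d)%N -> esym_tail k d = 0.
Proof.
have [e] := ubnP (n - k); elim: e k d => // e IHe k [|d] //= lte.
rewrite leq_eqVlt => /predU1P[->|kn].
  by rewrite /esym_tail big_pred0 ?coef1 // => i; rewrite leqNgt ltn_ord.
move=> h; rewrite (esym_tailS (Ordinal kn)) /= !IHe ?mulr0 ?subr0 //; lia.
Qed.

Lemma esym_tail_mesym d : esym_tail 0 d = (-1) ^+ d * mesym n int d.
Proof.
rewrite /esym_tail; under eq_bigr do rewrite addrC.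
rewrite bigA_distr coef_sum /mesym mulr_sumr [RHS]big_mkcond /=.
apply: eq_bigr => J _.
rewrite -big_mkcond /= (eq_bigr (fun i => (- 'X_i)%:P * 'X)) => [|i _]; last first.
  by rewrite polyCN mulNr.
rewrite big_split /= prodr_const -rmorph_prod /= coefCM coefXn prodrN.
by rewrite eq_sym; case: eqP => [->|_]; rewrite ?mulr1 ?mulr0.
Qed.

(** Modulo the ideal the product of all 1 - x_i t is 1, so the inverse of the product over the first
    k variables is the product over the others. In coefficients, both families satisfy the same
    recursion. *)
Lemma hsym_esym (k d : nat) : (k <= n)%N -> hsym k d - esym_tail k d \in I.
Proof.
elim: k d => [|k IHk] d kn.
  rewrite esym_tail_mesym /=; case: d => [|d]; first by rewrite mul1r mesym0E subrr rpred0.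
  by rewrite sub0r rpredN; apply/coinvM/mesym_coinv.
elim: d => [|d IHd]; first by rewrite hsym0 esym_tail_at0 subrr rpred0.
rewrite hsymS (nvarE (Ordinal kn)).
have -> : esym_tail k.+1 d.+1 = esym_tail k d.+1 + 'X_(Ordinal kn) * esym_tail k.+1 d.
  by rewrite (esym_tailS (Ordinal kn)) /= subrK.
have aux (A : comNzRingType) (a b c e x : A) : a + x * b - (c + x * e) = (a - c) + x * (b - e).
  by ring.
by rewrite [X in X \in _]aux; exact: rpredD (IHk _ (ltnW kn)) (coinvM _ IHd).
Qed.

Definition supp_in (S : 'X_{1..n} -> Prop) p := forall m, m \in msupp p -> S m.

Lemma supp_in0 S : supp_in S 0.
Proof. by move=> m; rewrite msupp0. Qed.

Lemma supp_inD S p q : supp_in S p -> supp_in S q -> supp_in S (p + q).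
Proof. by move=> hp hq m /msuppD_le; rewrite mem_cat => /orP[/hp|/hq]. Qed.

Lemma supp_in_sum S (T : Type) (s : seq T) (F : T -> P) :
  (forall t, supp_in S (F t)) -> supp_in S (\sum_(t <- s) F t).
Proof. by move=> h; elim/big_rec: _ => [|t p _ hp]; [exact: supp_in0|exact: supp_inD]. Qed.

Lemma supp_inZ S (c : int) p : supp_in S p -> supp_in S (c *: p).
Proof. by move=> h m /msuppZ_le/h. Qed.

Lemma supp_inXM (S S' : 'X_{1..n} -> Prop) m p : (forall m', S m' -> S' (m + m')%MM) ->
  supp_in S p -> supp_in S' ('X_[m] * p).
Proof.
move=> SS' hp m'; rewrite mulrC (perm_mem (msuppMX p m)) => /mapP[m1 /hp/SS' h ->].
exact: h.
Qed.

Lemma supp_inX (S : 'X_{1..n} -> Prop) m : S m -> supp_in S 'X_[m].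
Proof. by move=> h m'; rewrite msuppX inE => /eqP->. Qed.

Lemma nvarXE i e : nvar i ^+ e = 'X_[U_(i) *+ e].
Proof. by rewrite nvarE mpolyXn. Qed.

Lemma mnmMnE i e j : (U_(i) *+ e)%MM j = ((i == j) * e)%N.
Proof. by rewrite mulmnE mnm1E. Qed.

Lemma supp_hsym (k d : nat) : (k <= n)%N ->
  supp_in (fun m => mdeg m = d /\ forall i, (k <= i)%N -> m i = 0%N) (hsym k d).
Proof.
elim: k d => [|k IHk] d kn /=.
  case: d => [|d]; last exact: supp_in0.
  by move=> m; rewrite msupp1 inE => /eqP->; rewrite mdeg0; split=> // i _; rewrite mnm0E.
apply: supp_in_sum => j; rewrite (nvarXE (Ordinal kn)).
apply: supp_inXM (IHk (d - j)%N (ltnW kn)) => m [md m0]; split.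
  by rewrite mdegD mdegMn mdeg1 md mul1n subnKC // -ltnS.
move=> i ki; rewrite mnmDE mnmMnE m0 1?ltnW // addn0.
by rewrite -val_eqE /= ltn_eqF.
Qed.

(** The element of the ideal is the complete symmetric polynomial of degree n - i in x_0, .., x_i.
    It is congruent to a coefficient of a product of only n - i - 1 linear factors, which is 0 in
    that degree. *)
Lemma coinv_lead i : exists r, 'X_i ^+ (n - i) + r \in I /\
  supp_in (fun m => [/\ mdeg m = (n - i)%N, forall l, (i < l)%N -> m l = 0%N
                      & (m i < n - i)%N]) r.
Proof.
have [d dE] : exists d, (n - i)%N = d.+1 by exists (n - i).-1; rewrite prednK // subn_gt0.
exists (\sum_(j < d.+1) nvar i ^+ j * hsym i (d.+1 - j)); split.
  have := hsym_esym d.+1 (ltn_ord i).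
  rewrite esym_tail_gt ?subr0 //; last by rewrite -dE subnS ltn_predL subn_gt0.
  by rewrite /= big_ord_recr /= subnn hsym0 mulr1 nvarE addrC dE.
apply: supp_in_sum => j; rewrite nvarXE.
have jd : (j <= d.+1)%N by rewrite ltnW.
apply: supp_inXM (supp_hsym (ltnW (ltn_ord i))) => m [md m0]; split.
- by rewrite mdegD mdegMn mdeg1 md mul1n dE subnKC.
- by move=> l il; rewrite mnmDE mnmMnE m0 1?ltnW // addn0 -val_eqE /= ltn_eqF.
by rewrite mnmDE mnmMnE eqxx mul1n m0 // addn0 dE.
Qed.

(** A termination measure: it drops when x_i^(n-i) is rewritten into the other monomials of the same
    degree in x_0, .., x_i. *)
Definition weight m := (\sum_(i < n) i * m i)%N.

Lemma weightD m1 m2 : weight (m1 + m2) = (weight m1 + weight m2)%N.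
Proof. by rewrite /weight -big_split; apply: eq_bigr => i _; rewrite mnmDE mulnDr. Qed.

Lemma degrevlex_trans m2 m1 m3 :
  degrevlex_lt m1 m2 -> degrevlex_lt m2 m3 -> degrevlex_lt m1 m3.
Proof.
have eqP' (a b : 'X_{1..n}) i : [forall j : 'I_n, (j < i)%N ==> (a j == b j)] ->
    forall j : 'I_n, (j < i)%N -> a j = b j.
  by move/forallP => h j ji; apply/eqP; exact: (implyP (h j)).
rewrite /degrevlex_lt.
case/orP => [h1|/andP[/eqP e1 /existsP[i /andP[i1 /eqP' i2]]]];
  case/orP => [h2|/andP[/eqP e2 /existsP[j /andP[j1 /eqP' j2]]]].
- by rewrite (ltn_trans h1 h2).
- by rewrite -e2 h1.
- by rewrite e1 h2.
rewrite e1 e2 eqxx ltnn /=; apply/existsP.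
have [ij|ji|/val_inj ij] := ltngtP i j.
- exists i; rewrite -(j2 i ij) i1 /=; apply/forallP => l; apply/implyP => li.
  by rewrite (i2 l li) (j2 l (ltn_trans li ij)).
- exists j; rewrite (i2 j ji) j1 /=; apply/forallP => l; apply/implyP => lj.
  by rewrite (i2 l (ltn_trans lj ji)) (j2 l lj).
rewrite -{}ij in j1 j2; exists i; rewrite (ltn_trans j1 i1) /=.
by apply/forallP => l; apply/implyP => li; rewrite (i2 l li) (j2 l li).
Qed.

Lemma degrevlex_irr m : degrevlex_lt m m = false.
Proof.
rewrite /degrevlex_lt ltnn /=; apply/negbTE; rewrite negb_and; apply/orP; right.
by apply/existsP => -[i]; rewrite ltnn.
Qed.

(** Having degree n - i but a smaller exponent at i, m' contains some x_l with l < i. The smallest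
    such variable is where the two monomials first differ, and the larger exponent there makes m +
    m' the smaller one. *)
Lemma lower_lead i m m' : mdeg m' = (n - i)%N -> (forall l, (i < l)%N -> m' l = 0%N) ->
    (m' i < n - i)%N ->
  (weight (m + m') < weight (m + U_(i) *+ (n - i)))%N /\
  degrevlex_lt (m + m') (m + U_(i) *+ (n - i))%MM.
Proof.
move=> md m0 mi.
have [l li ml] : exists2 l : 'I_n, (l < i)%N & (0 < m' l)%N.
  have [l /andP[li ml]|h] := pickP (fun l : 'I_n => (l < i) && (0 < m' l))%N.
    by exists l.
  move: mi; rewrite -md mdegE (bigD1 i) //= big1 ?addn0 ?ltnn // => l li.
  have := h l; case: (ltngtP l i) => [li'|/m0//|/val_inj e]; last by rewrite e eqxx in li.
  by rewrite /= lt0n => /negbFE/eqP.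
rewrite !weightD ltn_add2l; split.
  have -> : weight (U_(i) *+ (n - i)) = (\sum_j i * m' j)%N.
    rewrite -big_distrr /= -mdegE md /weight (bigD1 i) //= mnmMnE eqxx mul1n big1 ?addn0 //.
    by move=> j ji; rewrite mnmMnE eq_sym (negPf ji) muln0.
  rewrite /weight (bigD1 l) //= [X in (_ < X)%N](bigD1 l) //= -addSn leq_add //.
    by rewrite ltn_mul2r ml li.
  apply: leq_sum => j _; case: (leqP j i) => [ji|/m0->]; last by rewrite !muln0.
  by rewrite leq_mul2r ji orbT.
rewrite /degrevlex_lt !mdegD md mdegMn mdeg1 mul1n ltnn eqxx /=.
case: (arg_minnP (P := fun l : 'I_n => 0 < m' l)%N (fun l : 'I_n => l : nat) ml) => k mk kmin.
have ki : (k < i)%N by exact: leq_ltn_trans (kmin _ ml) li.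
apply/existsP; exists k; rewrite !mnmDE mnmMnE -val_eqE /= (gtn_eqF ki) addn0.
rewrite -[X in (X < _)%N]addn0 ltn_add2l mk /=; apply/forallP => j; apply/implyP => jk.
rewrite !mnmDE mnmMnE -val_eqE /= (gtn_eqF (ltn_trans jk ki)) addn0.
rewrite -[X in _ == X]addn0 eqn_add2l -leqn0 leqNgt; apply/negP => /kmin.
by rewrite leqNgt jk.
Qed.

Definition below_delta m := (m <= delta n)%MM.

Lemma not_below_delta m : ~~ below_delta m -> exists i, (n - i <= m i)%N.
Proof.
move=> h; apply/existsP; apply: contraNT h => /existsPn h.
apply/mnm_lepP => i; have := h i; rewrite -ltnNge mnmE subnS.
by case: (n - i)%N.
Qed.

Lemma reduce_seq (S : 'X_{1..n} -> Prop) (s : seq 'X_{1..n}) (c : 'X_{1..n} -> int) :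
    (forall m, m \in s -> exists q, 'X_[m] - q \in I /\ supp_in S q) ->
  exists q, \sum_(m <- s) c m *: 'X_[m] - q \in I /\ supp_in S q.
Proof.
elim: s => [|m s IHs] h; first exists 0.
  by rewrite big_nil subrr rpred0; split=> //; exact: supp_in0.
have [|q [qI qS]] := IHs; first by move=> m' m's; apply: h; rewrite inE m's orbT.
have [q' [q'I q'S]] := h m (mem_head _ _).
exists (c m *: q' + q); split; last by apply: supp_inD => //; exact: supp_inZ.
by rewrite big_cons opprD addrACA -scalerBr -mul_mpolyC; apply: rpredD => //; exact: coinvM.
Qed.

(** A factor x_i^(n-i) is rewritten by [coinv_lead] until none is left. The comparison with m is
    recorded because [reducedP] needs the leading monomial to survive the reduction of the lower
    terms. *)
Lemma reduce_monomial m : exists q, 'X_[m] - q \in I /\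
  supp_in (fun m' => below_delta m' /\ (m' = m \/ degrevlex_lt m' m)) q.
Proof.
have [e] := ubnP (weight m); elim: e m => // e IHe m; rewrite ltnS => we.
have [md|/not_below_delta[i mi]] := boolP (below_delta m).
  exists 'X_[m]; rewrite subrr rpred0; split=> //; apply: supp_inX; split=> //; by left.
pose mu := (m - U_(i) *+ (n - i))%MM.
have mE : m = (mu + U_(i) *+ (n - i))%MM.
  rewrite submK //; apply/mnm_lepP => j; rewrite mnmMnE.
  by case: eqP => [<-|_]; rewrite ?mul1n ?mul0n.
have [r [rI rS]] := coinv_lead i.
have [q [qI qS]] : exists q, 'X_[mu] * - r - q \in I /\
   supp_in (fun m' => below_delta m' /\ (m' = m \/ degrevlex_lt m' m)) q.
  have -> : 'X_[mu] * - r =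
      \sum_(m' <- [seq (mu + m')%MM | m' <- msupp r]) (- r@_(m' - mu)) *: 'X_[m'].
    rewrite big_map [in LHS](mpolyE r) mulrN mulr_sumr -sumrN; apply: eq_bigr => m' _.
    by rewrite addmC addmK -scalerAr scaleNr -mpolyXD addmC.
  apply: reduce_seq => _ /mapP[k /rS[k1 k2 k3] ->].
  have [h1 h2] := lower_lead mu k1 k2 k3; rewrite -mE in h1 h2.
  have [q [qI qS]] := IHe _ (leq_trans h1 we).
  exists q; split=> // m' /qS[bm' h]; split=> //; right.
  by case: h => [->//|/degrevlex_trans]; apply.
exists q; split=> //.
have aux (A : comNzRingType) (x y a b c : A) : x = a * y -> x - c = a * (y + b) + (a * - b - c).
  by move=> ->; ring.
have -> : 'X_[m] - q = 'X_[mu] * ('X_i ^+ (n - i) + r) + ('X_[mu] * - r - q).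
  by apply: aux; rewrite {1}mE mpolyXD mpolyXn.
by apply: rpredD => //; exact: coinvM.
Qed.

End Reduction.

(** * Normal forms *)

Section NormalForm.
Variable n : nat.
Local Notation P := {mpoly int[n]}.
Local Notation I := (@coinv_ideal n).
Implicit Types (p q r : P) (m : 'X_{1..n}) (i j k l : 'I_n).

Lemma reduce p : exists q, p - q \in I /\ supp_in (@below_delta n) q.
Proof.
rewrite [p]mpolyE; apply: reduce_seq => m _.
have [q [qI qS]] := reduce_monomial m.
by exists q; split=> // m' /qS[].
Qed.

(* The coordinates of the class of p in the basis x^(delta - b), as a generating
   function. *)
Definition coords p : P := integ (kernel (fun k : 'I_n => nvar n k) * mpoly_intr P p).

Lemma coords_eqv p q : eqv p q -> coords p = coords q.
Proof. by move=> h; apply/eqv_integ/eqvMl/eqv_lift. Qed.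

Lemma coords_coinv p q : p - q \in I -> coords p = coords q.
Proof.
move=> /coinv_eqv h; apply: coords_eqv; rewrite -[p](subrK q) -[X in eqv _ X]add0r.
exact: eqvD.
Qed.

Lemma coordsX m : below_delta m -> coords 'X_[m] = 'X_[delta n - m].
Proof.
move=> hm; rewrite /coords liftX -{1}[m](addmK (delta n - m)%MM) addmC submK //.
rewrite integ_kernel ?lem_subr // mpolyXE_id.
by apply: eq_bigr => i _; rewrite nvarE.
Qed.

Lemma coords_sum (s : seq 'X_{1..n}) (c : 'X_{1..n} -> int) :
  coords (\sum_(m <- s) c m *: 'X_[m]) = \sum_(m <- s) c m *: coords 'X_[m].
Proof.
rewrite /coords rmorph_sum mulr_sumr raddf_sum /=; apply: eq_bigr => m _.
rewrite /mpoly_intr map_mpolyZ -scalerAr linearZ /=.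
by rewrite mulrzl -scaler_int intz.
Qed.

Lemma coords_supp q : supp_in (@below_delta n) q ->
  coords q = \sum_(m <- msupp q) q@_m *: 'X_[delta n - m].
Proof.
move=> hq; rewrite {1}[q]mpolyE coords_sum; apply: eq_big_seq => m /hq hm.
by rewrite coordsX.
Qed.

Lemma mcoeff_coords q m : supp_in (@below_delta n) q -> below_delta m ->
  (coords q)@_(delta n - m) = q@_m.
Proof.
move=> hq hm; rewrite coords_supp // raddf_sum /=.
under eq_big_seq => m' /hq hm'.
  rewrite mcoeffZ mcoeffX (_ : (delta n - m' == delta n - m)%MM = (m' == m)); last first.
    apply/eqP/eqP => [e|-> //].
    by rewrite -[m'](addmK (delta n - m')%MM) addmC submK // e -{1}(submK hm) addmC addmK.
  over.
rewrite /=; have [mq|mq] := boolP (m \in msupp q).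
  rewrite (bigD1_seq m) //= eqxx mulr1 big1 ?addr0 // => m' /negPf ->.
  by rewrite mulr0.
rewrite (memN_msupp_eq0 mq) big_seq big1 // => m' m'q.
by case: eqP => [e|_]; rewrite ?mulr0 //; rewrite -e m'q in mq.
Qed.

(** The monomials dividing x^delta are independent modulo the ideal: [coords] vanishes on the ideal
    and yet recovers every coefficient of q. *)
Lemma supp_in_coinv0 q : supp_in (@below_delta n) q -> q \in I -> q = 0.
Proof.
move=> hq; rewrite -[X in X \in I]subr0 => /coords_coinv e.
apply/mpolyP => m; rewrite mcoeff0; have [mq|/memN_msupp_eq0//] := boolP (m \in msupp q).
have h0 : supp_in (@below_delta n) (0 : P) by exact: supp_in0.
have hm := hq m mq; apply: etrans (esym (mcoeff_coords hq hm)) _; rewrite e.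
exact: etrans (mcoeff_coords h0 hm) (mcoeff0 _ _).
Qed.

(** A monomial not dividing x^delta is the leading one of a multiple of some element of
    [coinv_lead]. Conversely, if p in the ideal had a leading monomial m dividing x^delta, reducing
    its lower terms would leave an element of the ideal supported below delta with nonzero
    coefficient at m, against [supp_in_coinv0]. *)
Lemma reducedP r : reduced r <-> supp_in (@below_delta n) r.
Proof.
split=> [rr m mr|hr m mr p pI [mp lead]].
  apply: contraT => /not_below_delta[i mi].
  pose mu := (m - U_(i) *+ (n - i))%MM.
  have mE : (mu + U_(i) *+ (n - i))%MM = m.
    rewrite submK //; apply/mnm_lepP => j; rewrite mnmMnE.
    by case: eqP => [<-|_]; rewrite ?mul1n ?mul0n.
  have [q [qI qS]] := coinv_lead i.
  have hq : supp_in (fun m' => degrevlex_lt m' m) ('X_[mu] * q).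
    apply: supp_inXM qS => m' [h1 h2 h3].
    by rewrite -mE; have [] := lower_lead mu h1 h2 h3.
  have pE : 'X_[mu] * ('X_i ^+ (n - i) + q) = 'X_[m] + 'X_[mu] * q.
    by rewrite mulrDr mpolyXn -mpolyXD mE.
  have mq : ('X_[mu] * q)@_m = 0.
    by apply: memN_msupp_eq0; apply/negP => /hq; rewrite degrevlex_irr.
  case: (rr m mr ('X_[mu] * ('X_i ^+ (n - i) + q))); first exact: coinvM.
  rewrite pE; split; first by rewrite mcoeff_msupp mcoeffD mcoeffX eqxx mq addr0 oner_eq0.
  move=> m' /msuppD_le; rewrite mem_cat msuppX inE => /orP[/eqP->|/hq//].
  by rewrite eqxx.
have hm := hr m mr.
have [q [qI qS]] : exists q, \sum_(m' <- rem m (msupp p)) p@_m' *: 'X_[m'] - q \in I /\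
    supp_in (fun m' => below_delta m' /\ degrevlex_lt m' m) q.
  apply: reduce_seq => m'; rewrite (mem_rem_uniq _ (msupp_uniq p)) inE => /andP[m'm m'p].
  have [q [qI qS]] := reduce_monomial m'; exists q; split=> // m'' /qS[h1 h2]; split=> //.
  have lt := lead _ m'p m'm.
  by case: h2 => [->//|/degrevlex_trans]; apply.
have q'I : p@_m *: 'X_[m] + q \in I.
  have -> : p@_m *: 'X_[m] + q = p - (\sum_(m' <- rem m (msupp p)) p@_m' *: 'X_[m'] - q).
    have pE : p = p@_m *: 'X_[m] + \sum_(m' <- rem m (msupp p)) p@_m' *: 'X_[m'].
      by rewrite {1}[p]mpolyE (perm_big _ (perm_to_rem mp)) big_cons.
    rewrite [X in _ = X - _]pE.
    have aux (V : zmodType) (a s t : V) : a + t = a + s - (s - t).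
      by rewrite opprB addrA addrAC addrK.
    exact: aux.
  exact: rpredB.
have q'S : supp_in (@below_delta n) (p@_m *: 'X_[m] + q).
  apply: supp_inD; first exact: supp_inZ (supp_inX hm).
  by move=> m' /qS[bm' _].
have := congr1 (mcoeff m) (supp_in_coinv0 q'S q'I).
rewrite mcoeffD mcoeffZ mcoeffX eqxx mulr1 mcoeff0 (memN_msupp_eq0 (p := q)) ?addr0.
  by move/eqP; rewrite mcoeff_eq0 mp.
by apply/negP => /qS[_]; rewrite degrevlex_irr.
Qed.

Lemma flag_class_eq p q : flag_class p = flag_class q <-> p - q \in I.
Proof. by rewrite (Quotient.idealrBE I p q); split => [/eqP|/eqP]. Qed.

(** [reduce] exhibits a normal form, so the choice operator does return one. *)
Lemma skew_schubertP u w :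
  supp_in (@below_delta n) (skew_schubert u w) /\
  schubert u * schubert (w * longest n)%g - skew_schubert u w \in I.
Proof.
have [q [qI qS]] := reduce (schubert u * schubert (w * longest n)%g).
have cE : schubert_class u * schubert_class (w * longest n)%g =
    flag_class (schubert u * schubert (w * longest n)%g).
  by rewrite /schubert_class /flag_class rmorphM.
have [] : is_normal_form (schubert_class u * schubert_class (w * longest n)%g) (skew_schubert u w).
  apply: epsilon_spec; exists q; rewrite cE; split; last exact/reducedP.
  by apply/esym/flag_class_eq.
by rewrite cE => /esym/flag_class_eq ? /reducedP.
Qed.

End NormalForm.

(** * Recovering the skew Schubert polynomial from its coordinates *)

Section SkewSchubert.
Variable n : nat.
Local Notation P := {mpoly int[n]}.
Local Notation F := {fraction {mpoly int[n]}}.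

Lemma coords_skew_schubert (u w : 'S_n) :
  coords (skew_schubert u w) =
  \sum_(g : {bseq n * n of step n} | increasing_chain u g w) chain_monomial g.
Proof.
have [_ /coords_coinv <-] := skew_schubertP u w.
rewrite -[LHS](sum_chains_integ (nvar n) u w); apply: eq_bigr => g _.
by apply: eq_bigr => e _; rewrite nvarE.
Qed.

(* Substitutes 1 / x_i for x_i, so that x^delta eval_inv(x^b) is x^delta / x^b. *)
Definition eval_inv : P -> F := mmap intr (fun i => (tofrac 'X_i)^-1).

HB.instance Definition _ := GRing.RMorphism.on eval_inv.

Lemma eval_invX m : eval_inv 'X_[m] = (tofrac 'X_[m])^-1.
Proof.
rewrite /eval_inv mmapX mpolyXE_id rmorph_prod /= -prodfV; apply: eq_bigr => i _.
by rewrite rmorphXn exprVn.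
Qed.

Lemma eval_inv_chain (g : seq (step n)) :
  eval_inv (chain_monomial g) = (tofrac (chain_monomial g))^-1.
Proof.
rewrite /chain_monomial !rmorph_prod -prodfV; apply: eq_bigr => e _.
exact: eval_invX.
Qed.

Lemma eval_invZ c p : eval_inv (c *: p) = c%:~R * eval_inv p.
Proof. by rewrite /eval_inv mmapZ. Qed.

Lemma tofracZ (c : int) (p : P) : tofrac (c *: p) = c%:~R * tofrac p.
Proof. by rewrite -mul_mpolyC -[c in LHS]intz rmorphM !rmorph_int. Qed.

(** [coords] sends x^m to x^(delta-m); inverting the variables and multiplying by x^delta restores
    x^m. *)
Lemma tofrac_coords (q : P) : supp_in (@below_delta n) q ->
  tofrac q = tofrac 'X_[delta n] * eval_inv (coords q).
Proof.
move=> hq; rewrite coords_supp // {1}[q]mpolyE !rmorph_sum mulr_sumr.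
apply: eq_big_seq => m /hq hm; rewrite /= tofracZ eval_invZ eval_invX mulrCA; congr (_ * _).
rewrite -{1}(submK hm) addmC mpolyXD rmorphM mulfK // tofrac_eq0.
by rewrite -msupp_eq0 msuppX.
Qed.

End SkewSchubert.

Theorem theorem1p2 (n : nat) (u w : 'S_n) (le_uw : bruhat_le u w) :
  tofrac (skew_schubert u w) =
    \sum_(g : {bseq n * n of step n} | increasing_chain u g w)
       tofrac 'X_[delta n] / tofrac (chain_monomial g)
    :> {fraction {mpoly int[n]}}.
Proof.
have [hq _] := skew_schubertP u w.
rewrite (tofrac_coords hq) coords_skew_schubert rmorph_sum mulr_sumr.
by apply: eq_bigr => g _; rewrite /= eval_inv_chain.
Qed.
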